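(* Let $K\ge1$ and $s\le\sin\frac{\pi}{2(K+1)}$. The extremal instance $(M_K^\star,y_0^\star)$ (defined in the context), with resolvent $L$ having eigenvalues $\zeta_j$, satisfies $$\operatorname{dist}(1,\sigma(L))=\min_j|\zeta_j-1|=\sin\frac{\pi}{2(K+1)}\ \ge\ s,$$ and its instance minimax is exactly $\frac1{K+1}$; in particular every method in $\mathcal{A}_\infty$ satisfies $\|r(y_K)\|\ge\frac1{K+1}$ on it. This is the largest possible value of the instance minimax over all instances $(M,y_0)$ with $M$ maximal monotone and $d_0=1$, of any floor. Moreover the roots-of-unity rotation instance (defined in the context), whose floor is $\sin\frac{\pi}{K+2}$, has instance minimax equal to $\frac1{K+1}$ up to a factor $\Theta(\log K)$ as $K\to\infty$.
   Context: For an instance $(M,y_0)$ with $M$ maximal monotone on a real Hilbert space, $J=(I+M)^{-1}$ is the resolvent (written $L$ when linear), $r(y)=J(y)-y$, and $d_0$ is the distance of $y_0$ to the zero set of $M$. The floor of a linear instance is $\operatorname{dist}(1,\sigma(L))$. Class $\mathcal{A}_\infty$: a method which from $y_0$ performs at each iteration $k=0,1,2,\dots$ exactly one resolvent evaluation $x_k=J(v_k)$ at a query point $v_k$ in the affine hull of $\{y_0,x_0,\dots,x_{k-1}\}$ and then chooses $y_{k+1}$ in the affine hull of $\{y_0,x_0,\dots,x_k\}$, all (real, sum-one) coefficients being allowed to depend arbitrarily on everything observed so far. The instance minimax (for budget $K$) is the infimum of $\|r(y_K)\|$ over methods in $\mathcal{A}_\infty$ on that instance; for linear instances it is the minimum of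 $\|(L-I)Q(L)y_0\|$ over real polynomials $Q$ with $Q(1)=1$, $\deg Q\le K$. $\mathbb{R}^2$ is identified with $\mathbb{C}$. Extremal instance: $n=K+1$, $\phi_j=\frac{(2j+1)\pi}{n}$, $\omega_j=e^{i\phi_j}$, $w_j=\frac1{n^2}\csc^2\frac{\phi_j}2$ for $j=0,\dots,n-1$. $M_K^\star$ is the skew-adjoint operator on $\mathbb{R}^{2n}=(\mathbb{R}^2)^n$ whose $j$-th block is multiplication by $-i\tan(\phi_j/2)$, with the convention that a block with $\phi_j=\pi$ is the normal cone operator of $\{0\}$ (resolvent $0$ on it); equivalently its resolvent $L$ acts on block $j$ as multiplication by $\zeta_j=\frac{1+\omega_j}2$. $y_0^\star$ has norm $\sqrt{w_j}$ on block $j$; then $\|y_0^\star\|=d_0=1$. Roots-of-unity rotation instance: $N=K+1$, $\theta_j=\frac{\pi j}{K+2}$, $j=1,\dots,N$; the operator on $\mathbb{R}^{2N}$ is the direct sum of blocks $x\mapsto\tan\theta_j\begin{pmatrix}0&-1\\1&0\end{pmatrix}x$ (with the normal cone operator of $\{0\}$ as the block when $\theta_j=\pi/2$), and the starting point has norm $a_j$ on block $j$, where $a_j^2=\csc\theta_j/\Lambda_K$, $\Lambda_K=\sum_{j=1}^N\csc\theta_j$. *)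

(* Defs.v *)
From mathcomp Require Import all_boot all_order all_algebra.
From mathcomp Require Import all_classical all_reals all_analysis.
From mathcomp Require Export complex.

Set Implicit Arguments.
Unset Strict Implicit.
Unset Printing Implicit Defensive.

Import Order.TTheory GRing.Theory Num.Theory numFieldNormedType.Exports.
Local Open Scope classical_set_scope.
Local Open Scope ring_scope.
Local Open Scope complex_scope.

Definition csc (R : realType) (x : R) : R := (sin x)^-1.

Section Hilbert.
Variables (R : realType) (V : lmodType R).
Implicit Types (ip : V -> V -> R) (M : V -> set V) (x y z : V).

Definition inner_product ip : Prop :=
  [/\ forall x y, ip x y = ip y x,
      forall (a : R) x y z, ip (a *: x + y) z = a * ip x z + ip y z &
      forall x, x != 0 -> 0 < ip x x].

Definition hnorm ip x : R := Num.sqrt (ip x x).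

Definition norm_complete ip : Prop :=
  forall u : nat -> V,
    (forall e : R, 0 < e -> exists N : nat, forall m n : nat,
       (N <= m)%N -> (N <= n)%N -> hnorm ip (u m - u n) < e) ->
    exists l : V, forall e : R, 0 < e -> exists N : nat, forall n : nat,
      (N <= n)%N -> hnorm ip (u n - l) < e.

Definition hilbert ip : Prop := inner_product ip /\ norm_complete ip.

Definition monotone ip M : Prop :=
  forall x y u v, M x u -> M y v -> 0 <= ip (x - y) (u - v).

Definition maximal_monotone ip M : Prop :=
  monotone ip M /\
  forall M' : V -> set V, monotone ip M' ->
    (forall x, M x `<=` M' x) -> forall x, M' x `<=` M x.

Definition is_instance ip M : Prop := hilbert ip /\ maximal_monotone ip M.

(* [y - x \in M x] says [y \in (I + M) x]; for maximal monotone [M] such an [x]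
   exists (Minty) and is unique, so the default value [0] is never used. *)
Definition resolvent M y : V := xget 0 [set x | M x (y - x)].

Definition residual M y : V := resolvent M y - y.

Definition zeros M : set V := [set x | M x 0].

(* [inf set0 = 0], so [dist_zeros ip M y = 1] forces [zeros M] to be nonempty. *)
Definition dist_zeros ip M y : R := inf [set hnorm ip (y - z) | z in zeros M].

(* Weighted sum of the entries of a history [y_0; x_0; ...; x_(k-1)]. *)
Definition combination (c : nat -> R) (h : seq V) : V :=
  \sum_(i < size h) c i *: h`_i.

(* The coefficients are arbitrary functions of the history of observations;
   the previous queries and iterates are themselves determined by it. *)
Record method : Type := Method {
  query_coef : seq V -> nat -> R;
  output_coef : seq V -> nat -> R;
  query_coef_sum1 : forall h : seq V, (0 < size h)%N ->
    \sum_(i < size h) query_coef h i = 1;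
  output_coef_sum1 : forall h : seq V, (0 < size h)%N ->
    \sum_(i < size h) output_coef h i = 1 }.

(* [history m J y0 k] is [y_0; x_0; ...; x_(k-1)]. *)
Fixpoint history (m : method) (J : V -> V) (y0 : V) (k : nat) : seq V :=
  if k is k'.+1 then
    let h := history m J y0 k' in
    rcons h (J (combination (query_coef m h) h))
  else [:: y0].

(* [iterate m J y0 k] is [y_k], which uses the evaluations [x_0, ..., x_(k-1)]. *)
Definition iterate (m : method) (J : V -> V) (y0 : V) (k : nat) : V :=
  if k is 0%N then y0
  else let h := history m J y0 k in combination (output_coef m h) h.

Definition final_residual ip M (y0 : V) (K : nat) (m : method) : R :=
  hnorm ip (residual M (iterate m (resolvent M) y0 K)).

Definition minimax ip M (y0 : V) (K : nat) : R :=
  inf (range (final_residual ip M y0 K)).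

(* Spectral notions of a real operator are those of its complexification, which
   acts on [V * V] with [(x, y)] standing for [x + i y]. *)
Definition cscale (z : R[i]) (p : V * V) : V * V :=
  (complex.Re z *: p.1 - complex.Im z *: p.2, complex.Re z *: p.2 + complex.Im z *: p.1).

Definition complexify (L : V -> V) (p : V * V) : V * V := (L p.1, L p.2).

Definition eigenvalues (L : V -> V) : set R[i] :=
  [set z | exists2 p : V * V, p != 0 & complexify L p = cscale z p].

(* For bounded [L] on a Hilbert space, a bijective [L - z] has a bounded
   inverse by the open mapping theorem. *)
Definition spectrum (L : V -> V) : set R[i] :=
  [set z | ~ bijective (fun p : V * V => complexify L p - cscale z p)].

Definition floor_of (L : V -> V) : R :=
  inf [set Normc.normc (1 - z) | z in spectrum L].

End Hilbert.

(* [Rcomplex R] is [R[i]] as a real vector space: the identification of [R^2]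
   with the complex plane. *)
Notation blocks R n := {ffun 'I_n -> Rcomplex R}.

Section Blocks.
Variables (R : realType) (n : nat).

Definition ip_block (z w : Rcomplex R) : R := complex.Re z * complex.Re w + complex.Im z * complex.Im w.

Definition ip_blocks (x y : blocks R n) : R := \sum_j ip_block (x j) (y j).

Definition direct_sum (B : 'I_n -> Rcomplex R -> set (Rcomplex R))
    (x : blocks R n) : set (blocks R n) :=
  [set u | forall j, B j (x j) (u j)].

End Blocks.

Definition normal_cone (R : realType) (C : set (Rcomplex R)) (x : Rcomplex R) :
    set (Rcomplex R) :=
  [set u | C x /\ forall z, C z -> ip_block u (z - x) <= 0].

Section Extremal.
Variables (R : realType) (K : nat).
Implicit Type j : 'I_K.+1.

Definition phi j : R := (j.*2.+1)%:R * pi / K.+1%:R.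

Definition omega j : R[i] := cos (phi j) +i* sin (phi j).

Definition zeta j : R[i] := (1 + omega j) / 2%:R.

Definition weight j : R := csc (phi j / 2%:R) ^+ 2 / K.+1%:R ^+ 2.

Definition extremal_block j (z : Rcomplex R) : set (Rcomplex R) :=
  if phi j == pi then normal_cone [set 0] z
  else [set (0 -i* tan (phi j / 2%:R)) * z].

Definition extremal_op : blocks R K.+1 -> set (blocks R K.+1) :=
  direct_sum extremal_block.

(* Only the norms of the blocks of the starting point are prescribed. *)
Definition extremal_start (y0 : blocks R K.+1) : Prop :=
  forall j, Normc.normc (y0 j) = Num.sqrt (weight j).

End Extremal.

Section Rotation.
Variables (R : realType) (K : nat).
Implicit Type j : 'I_K.+1.

(* [j : 'I_K.+1] stands for the index [j + 1] ranging over 1, ..., K + 1. *)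
Definition theta j : R := pi * j.+1%:R / K.+2%:R.

Definition Lambda : R := \sum_(j < K.+1) csc (theta j).

Definition rotation_block j (z : Rcomplex R) : set (Rcomplex R) :=
  if theta j == pi / 2%:R then normal_cone [set 0] z
  else [set tan (theta j) *: ((- complex.Im z) +i* complex.Re z : Rcomplex R)].

Definition rotation_op : blocks R K.+1 -> set (blocks R K.+1) :=
  direct_sum rotation_block.

Definition rotation_start (y0 : blocks R K.+1) : Prop :=
  forall j, Normc.normc (y0 j) = Num.sqrt (csc (theta j) / Lambda).

End Rotation.

Arguments extremal_op : clear implicits.
Arguments rotation_op : clear implicits.
Arguments phi {R K} j.
Arguments omega {R K} j.
Arguments zeta {R K} j.
Arguments weight {R K} j.
Arguments theta {R K} j.
Arguments Lambda : clear implicits.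
Arguments ip_blocks {R n} x y.

(* Main.v *)
Require Import Defs.
From mathcomp Require Import all_boot all_order all_algebra.
From mathcomp Require Import all_classical all_reals all_analysis.
From mathcomp Require Import ring lra zify.

Set Implicit Arguments.
Unset Strict Implicit.
Unset Printing Implicit Defensive.

Import Order.TTheory GRing.Theory Num.Theory numFieldNormedType.Exports.
Import ComplexField.
Local Open Scope classical_set_scope.
Local Open Scope ring_scope.

(** A resolvent is everywhere defined because a maximal monotone graph can be
    extended at any point: maximizing the concave dual function
    [- |(a - b) / 2|^2 - q] over the convex hull of the points [(a, b, <a, b>)]
    of the (shifted) graph, near-maximizers have Cauchy midpoints [(a - b) / 2],
    and their limit is the point sought.  Halpern's iteration then gives
    [|r(y_K)| <= d_0 / (K + 1)] on every instance.

    On a direct sum of plane rotations every method outputs [P(omega)] times the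
    starting point, blockwise, with [P] a real polynomial of degree at most [K]
    and [P(1) = 1], where [(1 + omega_j) / 2] are the eigenvalues of the
    resolvent.  For the extremal instance the [omega_j] are the roots of
    [z^n = -1], [n = K + 1], and the squared residual is the mean of
    [|P(omega_j)|^2] divided by [n]; by Parseval it is [(sum_k p_k^2) / n], hence
    at least [1 / n^2].  For the rotation instance the [omega_j] are the
    nontrivial roots of unity of order [N = K + 2], where
    [P(1) = - sum_j omega_j P(omega_j)]; by Cauchy-Schwarz the instance minimax
    is exactly [1 / Lambda_K], and [Lambda_K / (K + 1)] is of order [ln K]
    by comparison with the harmonic sum. *)

(** * Inner products *)

Section InnerProduct.
Variables (R : realType) (V : lmodType R) (ip : V -> V -> R).
Hypothesis ip_inner : inner_product ip.

Lemma ipC x y : ip x y = ip y x. Proof. by case: ip_inner. Qed.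

Lemma ipDl x y z : ip (x + y) z = ip x z + ip y z.
Proof. by case: ip_inner => _ lin _; rewrite -[x]scale1r lin mul1r scale1r. Qed.

Lemma ip0l z : ip 0 z = 0.
Proof. by apply: (addrI (ip 0 z)); rewrite -ipDl !addr0. Qed.

Lemma ipZl a x z : ip (a *: x) z = a * ip x z.
Proof. by case: ip_inner => _ lin _; rewrite -[a *: x]addr0 lin ip0l addr0. Qed.

Lemma ipNl x z : ip (- x) z = - ip x z.
Proof. by rewrite -scaleN1r ipZl mulN1r. Qed.

Lemma ipDr x y z : ip x (y + z) = ip x y + ip x z.
Proof. by rewrite ipC ipDl !(ipC _ x). Qed.

Lemma ipZr a x z : ip x (a *: z) = a * ip x z.
Proof. by rewrite ipC ipZl ipC. Qed.

Lemma ipNr x z : ip x (- z) = - ip x z.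
Proof. by rewrite ipC ipNl ipC. Qed.

Definition ipE := (ipDl, ipDr, ipNl, ipNr, ipZl, ipZr).

Lemma ip_ge0 x : 0 <= ip x x.
Proof.
have [->|x0] := eqVneq x 0; first by rewrite ip0l.
by case: ip_inner => _ _ pos; exact/ltW/pos.
Qed.

Lemma hnorm_sqr x : hnorm ip x ^+ 2 = ip x x.
Proof. by rewrite sqr_sqrtr ?ip_ge0. Qed.

Lemma hnorm_ge0 x : 0 <= hnorm ip x. Proof. exact: sqrtr_ge0. Qed.

(** Cauchy-Schwarz: the squared norm of [ip x x *: y - ip x y *: x] is [ip x x] times the Gram
    determinant of [x] and [y]. *)
Lemma ip_le_hnorm x y : ip x y <= hnorm ip x * hnorm ip y.
Proof.
have [->|x0] := eqVneq x 0; first by rewrite ip0l mulr_ge0 ?hnorm_ge0.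
have xx : 0 < ip x x by case: ip_inner => _ _; apply.
have := ip_ge0 (ip x x *: y - ip x y *: x).
rewrite !ipE (ipC y x) => h.
have {h} : 0 <= ip x x * (ip x x * ip y y - ip x y ^+ 2) by nra.
rewrite pmulr_rge0// subr_ge0 => h.
apply: le_trans (ler_norm _) _.
rewrite -(@ler_pXn2r _ 2) ?nnegrE ?mulr_ge0 ?hnorm_ge0 ?normr_ge0//.
by rewrite exprMn !hnorm_sqr real_normK ?num_real.
Qed.

Lemma ip_sub_shift x y z :
  ip (y - z) (y - z) =
  ip (x - z) (x - z) - 2 * ip (x - y) (x - z) + ip (y - x) (y - x).
Proof. by rewrite !ipE !(ipC y x) !(ipC z x) (ipC z y); ring. Qed.

Lemma hnormBC x y : hnorm ip (x - y) = hnorm ip (y - x).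
Proof. by rewrite /hnorm -opprB ipNl ipNr opprK. Qed.

End InnerProduct.

(** * Minty's theorem *)

Lemma le0_linear_bound (R : realType) (A B : R) :
  (forall e, 0 < e -> e < 1 -> A <= e * B) -> A <= 0.
Proof.
move=> h; rewrite leNgt; apply/negP => A0.
(* This choice gives [e * B <= e * (A + |B|) = A / 2 < A] while keeping [e < 1]. *)
set e := A / (2 * (A + `|B|)).
have D0 : 0 < A + `|B| by rewrite ltr_wpDr.
have e0 : 0 < e by rewrite divr_gt0// mulr_gt0.
have e1 : e < 1.
  by rewrite ltr_pdivrMr ?mulr_gt0// mul1r; have := normr_ge0 B; lra.
have := h e e0 e1.
have eD : e * (A + `|B|) = A / 2 by rewrite /e; field; rewrite gt_eqF.
by have := ler_norm B; nra.
Qed.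

Section Minty.
Variables (R : realType) (V : lmodType R) (ip : V -> V -> R).
Hypothesis ip_hilbert : hilbert ip.
Variable G : V -> V -> Prop.
Hypothesis G_monotone : forall a b c d, G a b -> G c d -> 0 <= ip (a - c) (b - d).

Let inn : inner_product ip. Proof. by case: ip_hilbert. Qed.

(** Convex hull of the triples (a, b, <a, b>), generated by binary combinations so that its
    properties follow by induction. *)
Inductive graph_hull : V -> V -> R -> Prop :=
| GraphHullBase a b : G a b -> graph_hull a b (ip a b)
| GraphHullConv t a b q a' b' q' : 0 <= t -> t <= 1 ->
    graph_hull a b q -> graph_hull a' b' q' ->
    graph_hull ((1 - t) *: a + t *: a') ((1 - t) *: b + t *: b')
               ((1 - t) * q + t * q').

(** On two graph points the expression is <a - a', b - b'>. It is affine in each triple separately,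
    so monotonicity passes to the hull by one induction per triple. *)
Lemma graph_hull_monotone a b q a' b' q' :
  graph_hull a b q -> graph_hull a' b' q' -> 0 <= q + q' - ip a b' - ip a' b.
Proof.
move=> h; elim: h a' b' q' => {a b q} [a b Gab|t a b q c d p t0 t1 _ IH1 _ IH2] a' b' q' h'.
  elim: h' => {a' b' q'} [c d Gcd|t c d p c' d' p' t0 t1 _ IH1 _ IH2].
    by have := G_monotone Gab Gcd; rewrite !(ipE inn); lra.
  by rewrite !(ipE inn); nra.
by have := IH1 _ _ _ h'; have := IH2 _ _ _ h'; rewrite !(ipE inn); nra.
Qed.

Lemma graph_hull_ip a b q : graph_hull a b q -> ip a b <= q.
Proof. by move=> h; have := graph_hull_monotone h h; lra. Qed.

(* The dual function of the problem of minimizing, over [x], the largest of the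
   values [ip (x - a) (x + b)] for [(a, b)] in [G]. *)
Let dual a b q : R := - (ip (a - b) (a - b) / 4) - q.

Let dual_values : set R :=
  [set g | exists a b q, graph_hull a b q /\ g = dual a b q].

(** Since [q >= ip a b], the value is at most -|a - b|^2 / 4 - <a, b> = -|a + b|^2 / 4. *)
Lemma dual_le0 a b q : graph_hull a b q -> dual a b q <= 0.
Proof.
move=> /graph_hull_ip h; rewrite /dual; have := ip_ge0 inn (a + b).
by rewrite !(ipE inn) (ipC inn b a); lra.
Qed.

Lemma dual_sup a0 b0 : G a0 b0 -> has_sup dual_values.
Proof.
move=> G0; split.
  by exists (dual a0 b0 (ip a0 b0)), a0, b0, (ip a0 b0); split=> //; exact: GraphHullBase.
by exists 0 => _ [a [b [q [h ->]]]]; exact: dual_le0.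
Qed.

(** Strong concavity: the left side is exactly the dual value at the convex combination of the two
    triples, which lies in the hull. *)
Lemma dual_conv t a b q a' b' q' : 0 <= t -> t <= 1 ->
  graph_hull a b q -> graph_hull a' b' q' ->
  (1 - t) * dual a b q + t * dual a' b' q' + t * (1 - t) *
    ip (2^-1 *: (a - b) - 2^-1 *: (a' - b')) (2^-1 *: (a - b) - 2^-1 *: (a' - b'))
  <= sup dual_values.
Proof.
move=> t0 t1 h h'.
have bounded : has_ubound dual_values.
  by exists 0 => _ [? [? [? [hull ->]]]]; exact: dual_le0.
have := ub_le_sup bounded
  (ex_intro _ _ (ex_intro _ _ (ex_intro _ _ (conj (GraphHullConv t0 t1 h h') erefl)))).
apply: le_trans; rewrite /dual !(ipE inn).
rewrite !(ipC inn b a) !(ipC inn a' a) !(ipC inn b' a) !(ipC inn a' b).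
rewrite !(ipC inn b' b) !(ipC inn b' a').
by rewrite le_eqVlt; apply/orP; left; apply/eqP; field.
Qed.

(** The conclusion says that the pair (x, -x) is monotonically related to the whole graph. *)
Lemma monotone_extension_point : (exists a b, G a b) ->
  exists x, forall a b, G a b -> ip (x - a) (x + b) <= 0.
Proof.
move=> [a0 [b0 G0]]; set S := sup dual_values.
pose near_max e x := exists a b q,
  [/\ graph_hull a b q, x = 2^-1 *: (a - b) & S - e < dual a b q].
have near_max_ex e : 0 < e -> exists x, near_max e x.
  move=> e0; have [_ [a [b [q [h ->]]]] lt] := sup_adherent e0 (dual_sup G0).
  by exists (2^-1 *: (a - b)), a, b, q.
have near_max_close e x x' : near_max e x -> near_max e x' ->
    ip (x - x') (x - x') <= 4 * e.
  move=> [a [b [q [h -> lt]]]] [a' [b' [q' [h' -> lt']]]].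
  (* At the midpoint, t = 1/2, strong concavity yields S - e + |x - x'|^2 / 4 <= S. *)
  have t0 : 0 <= 2^-1 :> R by lra.
  have t1 : 2^-1 <= 1 :> R by lra.
  by have := dual_conv t0 t1 h h'; rewrite /= -/S; nra.
have near_max_mono e e' x : e <= e' -> near_max e x -> near_max e' x.
  by move=> le [a [b [q [h -> lt]]]]; exists a, b, q; split=> //; lra.
have [u hu] : exists u : nat -> V, forall n, near_max (n.+1%:R^-1) (u n).
  have /choice[u hu] : forall n : nat, exists x, near_max (n.+1%:R^-1) x.
    by move=> n; apply: near_max_ex; rewrite invr_gt0.
  by exists u.
have u_near e : 0 < e -> exists N, forall n, (N <= n)%N -> near_max e (u n).
  move=> e0; exists (Num.bound e^-1) => n len; apply: near_max_mono (hu n).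
  rewrite -[leRHS]invrK lef_pV2 ?posrE ?invr_gt0 ?ltr0n//.
  apply/ltW/(lt_le_trans (archi_boundP _)); first by rewrite invr_ge0 ltW.
  by rewrite ler_nat (leq_trans len).
have [x hx] : exists l : V, forall e : R, 0 < e -> exists N : nat, forall n : nat,
      (N <= n)%N -> hnorm ip (u n - l) < e.
  case: ip_hilbert => _; apply => e e0.
  have [] := u_near (e ^+ 2 / 8); first by rewrite divr_gt0 ?exprn_gt0.
  move=> N hN; exists N => m n lem len.
  rewrite -(@ltr_pXn2r _ 2) ?nnegrE ?hnorm_ge0 ?ltW// hnorm_sqr//.
  have := near_max_close _ _ _ (hN _ lem) (hN _ len).
  have e2 : 0 < e ^+ 2 by rewrite exprn_gt0.
  by lra.
exists x => a b Gab.
set x2 := 2^-1 *: (a - b); set g2 := dual a b (ip a b).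
(* Completing the square in [x] makes the dual value of (a, b) appear. *)
have -> : ip (x - a) (x + b) = ip (x - x2) (x - x2) + g2.
  rewrite /g2 /dual /x2 !(ipE inn) !(ipC inn a x) !(ipC inn b x) !(ipC inn b a).
  by field.
set D := hnorm ip (x - x2).
have D0 : 0 <= D by exact: hnorm_ge0.
(* Strong concavity is applied between (a, b) and a near-maximizer whose midpoint [x1] is within [e]
   of [x]. As its dual value is nonpositive and above S - e, the terms in [t] sum to at most [e];
   replacing [x1] by [x] costs the remaining multiple of [e]. *)
have step t e : 0 < t -> t < 1 -> 0 < e -> e < 1 ->
    t * (g2 + (1 - t) * D ^+ 2) <= e * (1 + 2 * t * (1 - t) * D).
  move=> t0 t1 e0 e1.
  have [N1 h1] := u_near _ e0; have [N2 h2] := hx _ e0.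
  have := h2 _ (leq_maxr N1 N2); have := h1 _ (leq_maxl N1 N2).
  move: (u _) => x1 [a1 [b1 [q1 [hull1 x1E lt1]]]] close.
  have := dual_conv (ltW t0) (ltW t1) hull1 (GraphHullBase Gab).
  rewrite /= -/S -/x2 -/g2 -x1E => le.
  have g1 := dual_le0 hull1.
  have := ip_le_hnorm inn (x - x1) (x - x2).
  rewrite (hnormBC inn x x1) -/D => cs.
  have {cs} cs : ip (x - x1) (x - x2) <= e * D.
    by apply: le_trans cs _; rewrite ler_wpM2r// ltW.
  have E : ip (x1 - x2) (x1 - x2) =
      D ^+ 2 - 2 * ip (x - x1) (x - x2) + ip (x1 - x) (x1 - x).
    by rewrite /D hnorm_sqr// (ip_sub_shift inn x).
  have := ip_ge0 inn (x1 - x); rewrite E in le => p.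
  have tt : 0 <= t * (1 - t) by nra.
  have le2 : t * (1 - t) * (D ^+ 2 - 2 * (e * D)) <=
     t * (1 - t) * (D ^+ 2 - 2 * ip (x - x1) (x - x2) + ip (x1 - x) (x1 - x)).
    by apply: ler_wpM2l => //; lra.
  by nra.
rewrite -hnorm_sqr// -/D addrC.
(* Two limits: [e] tends to 0 with [t] fixed, then, after division by [t], [t] tends to 0. *)
apply: (@le0_linear_bound _ _ (D ^+ 2)) => t t0 t1.
have : t * (g2 + (1 - t) * D ^+ 2) <= 0.
  by apply: le0_linear_bound => e e0 e1; exact: step.
by rewrite pmulr_rle0//; lra.
Qed.

End Minty.

(** * Existence of resolvents *)

Section Resolvent.
Variables (R : realType) (V : lmodType R) (ip : V -> V -> R) (M : V -> set V).
Hypothesis M_instance : is_instance ip M.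

Let inn : inner_product ip. Proof. by case: M_instance => -[]. Qed.

(** The extension point of the graph translated by [-y] gives a pair (x, y - x) monotonically
    related to [M]; adjoining it keeps the graph monotone, so maximality places it in [M]. *)
Lemma minty : (exists a b, M a b) -> forall y, exists x, M x (y - x).
Proof.
case: M_instance => hil [mon max] [a0 [b0 M0]] y.
have [] := @monotone_extension_point R V ip hil (fun a b => M a (b + y)).
- move=> a b c d Mab Mcd; have := mon _ _ _ _ Mab Mcd.
  by rewrite opprD addrACA subrr addr0.
- by exists a0, (b0 - y); rewrite subrK.
move=> x hx; exists x.
have ext a b : M a b -> 0 <= ip (x - a) (y - x - b).
  move=> Mab; have := hx a (b - y); rewrite subrK => /(_ Mab).
  have -> : y - x - b = - (x + (b - y)) by rewrite !opprD opprK addrA [RHS]addrC addrA.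
  by rewrite (ipNr inn) oppr_ge0.
apply: (max (fun a => [set b | M a b \/ a = x /\ b = y - x])); last by right.
  move=> a c b d [Mab|[-> ->]] [Mcd|[-> ->]].
  - exact: mon.
  - by have := ext _ _ Mab; rewrite -(opprB a x) -(opprB b) (ipNl inn) (ipNr inn) opprK.
  - exact: ext.
  - by rewrite !subrr (ip0l inn).
by move=> a b Mab; left.
Qed.

Lemma resolvent_mem y : (exists a b, M a b) ->
  M (resolvent M y) (y - resolvent M y).
Proof. by move=> /minty /(_ y) [x hx]; apply: (@xgetPex _ 0 [set x | M x (y - x)]); exists x. Qed.

End Resolvent.

(** * Methods and Halpern's iteration *)

Section Methods.
Variables (R : realType) (V : lmodType R).
Implicit Types (J : V -> V) (m : method V).

Lemma size_history m J y0 k : size (history m J y0 k) = k.+1.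
Proof. by elim: k => //= k IH; rewrite size_rcons IH. Qed.

Lemma combination_rcons (c : nat -> R) (h : seq V) x :
  combination c (rcons h x) = combination c h + c (size h) *: x.
Proof.
rewrite /combination size_rcons big_ord_recr /= nth_rcons ltnn eqxx.
by congr (_ + _); apply: eq_bigr => i _; rewrite nth_rcons ltn_ord.
Qed.

Lemma history_last m J y0 k :
  history m J y0 k.+1 = rcons (history m J y0 k)
    (J (combination (query_coef m (history m J y0 k)) (history m J y0 k))).
Proof. by []. Qed.

Lemma history_nth0 m J y0 k : (history m J y0 k)`_0 = y0.
Proof. by elim: k => //= k IH; rewrite nth_rcons size_history. Qed.

End Methods.

(** * Halpern's iteration and its rate *)

Section Halpern.
Variable R : realType.

(** Coefficients on the history of y_{k+1} = y_0 / (k+2) + (k+1)/(k+2) (2 J y_k - y_k). Index 0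
    stands for y_0 and index i+1 for x_i. *)
Fixpoint halpern_coef (k i : nat) : R :=
  if k is k'.+1 then
    k.+1%:R^-1 * (i == 0)%N%:R +
    k%:R / k.+1%:R * (2 * (i == k)%:R - halpern_coef k' i)
  else (i == 0)%N%:R.

Lemma halpern_coef_large k i : (k < i)%N -> halpern_coef k i = 0.
Proof.
elim: k i => [|k IH] [|i]//= ki; rewrite IH; last exact: ltnW.
by rewrite gtn_eqF// !mulr0 subr0 mulr0 addr0.
Qed.

Lemma sum_halpern_coef k : \sum_(i < k.+1) halpern_coef k i = 1.
Proof.
elim: k => [|k IH]; first by rewrite big_ord1.
have first_sum : \sum_(i < k.+2) (i == 0 :> nat)%:R = 1 :> R.
  by rewrite big_ord_recl big1 ?addr0.
have last_sum : \sum_(i < k.+2) (i == k.+1 :> nat)%:R = 1 :> R.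
  rewrite big_ord_recr /= eqxx big1 ?add0r// => i _.
  by rewrite ltn_eqF.
have prev_sum : \sum_(i < k.+2) halpern_coef k i = 1.
  by rewrite big_ord_recr /= halpern_coef_large// IH addr0.
rewrite /= big_split /= -!mulr_sumr big_split /= sumrN -!mulr_sumr.
rewrite first_sum last_sum prev_sum (_ : 2 * 1 - 1 = 1); last by ring.
by rewrite !mulr1 -[X in X + _]mul1r -mulrDl nat1r divff ?pnatr_eq0.
Qed.

(** Query and output share their coefficients: J is always evaluated at the current iterate. *)
Definition halpern (V : lmodType R) : method V.
Proof.
refine (@Method R V (fun h => halpern_coef (size h).-1)
                    (fun h => halpern_coef (size h).-1) _ _);
  by case=> // x h _; exact: sum_halpern_coef.
Defined.

Variables (V : lmodType R) (ip : V -> V -> R) (M : V -> set V).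
Hypothesis M_instance : is_instance ip M.
Variables y0 z : V.
Hypothesis M_z : M z 0.

Let inn : inner_product ip. Proof. by case: M_instance => -[]. Qed.
Let J := resolvent M.
Let g y := y - J y.
Let y k := iterate (halpern V) J y0 k.

Lemma resolvent_residual w : J w = w - g w.
Proof. by rewrite /g opprB addrC subrK. Qed.

(** Firm nonexpansiveness of I - J, which is monotonicity of [M] at the pairs (J u, g u) and (J v, g
    v). *)
Lemma monotone_residual u v : ip (g u - g v) (g u - g v) <= ip (g u - g v) (u - v).
Proof.
have mem w : M (J w) (g w) by apply: resolvent_mem M_instance _ _; exists z, 0.
case: M_instance => _ [mon _]; have := mon _ _ _ _ (mem u) (mem v).
have -> : J u - J v = (u - v) - (g u - g v).
  by rewrite !resolvent_residual !opprD !opprK addrACA.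
by rewrite (ipDl inn) (ipNl inn) (ipC inn (u - v)); lra.
Qed.

Lemma halpern_step k :
  y k.+1 = k.+2%:R^-1 *: y0 + (k.+1%:R / k.+2%:R) *: (y k - 2 *: g (y k)).
Proof.
have yE n : y n = combination (halpern_coef n) (history (halpern V) J y0 n).
  case: n => [|n]; first by rewrite /y /combination /= big_ord1 scale1r.
  by rewrite /y /iterate /= size_rcons size_history.
rewrite yE history_last combination_rcons size_history.
rewrite (_ : combination (query_coef _ _) _ = y k); last first.
  by rewrite yE /= size_history.
rewrite (resolvent_residual (y k)).
have -> : combination (halpern_coef k.+1) (history (halpern V) J y0 k) =
    k.+2%:R^-1 *: y0 - (k.+1%:R / k.+2%:R) *: y k.
  rewrite yE /combination scaler_sumr size_history -sumrN.
  rewrite -[in k.+2%:R^-1 *: y0](history_nth0 (halpern V) J y0 k).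
  set h := history _ _ _ _.
  have -> : k.+2%:R^-1 *: h`_0 =
      \sum_(i < k.+1) (k.+2%:R^-1 * (i == 0 :> nat)%:R) *: h`_i.
    by rewrite big_ord_recl big1 ?addr0 ?mulr1// => i _; rewrite mulr0 scale0r.
  rewrite -big_split; apply: eq_bigr => i _ /=.
  rewrite (ltn_eqF (ltn_ord i)) mulr0 sub0r mulrN.
  by rewrite scalerA scalerBl.
rewrite /= eqxx halpern_coef_large// subr0 mulr0 add0r mulr1.
rewrite -addrA; congr (_ + _).
move: (y k) (g (y k)) => yk gk; rewrite !scalerBr !scalerA addrA; congr (_ - _).
by rewrite -[- (_ *: yk)]scaleNr -scalerDl; congr (_ *: _); ring.
Qed.

Let E k := k%:R * k.+1%:R * ip (g (y k)) (g (y k)) +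
  k.+1%:R * ip (g (y k)) (y k - y0).

(** The potential vanishes at 0 and is nonincreasing: E k - E (k+1) equals (k+1)(k+2) times the
    slack in firm nonexpansiveness between consecutive iterates. *)
Lemma halpern_potential k : E k <= 0.
Proof.
elim: k => [|k IH]; first by rewrite /E {3}/y /= subrr (ipC inn) (ip0l inn) mulr0 addr0 !mul0r.
apply: le_trans IH; rewrite /E.
have := monotone_residual (y k.+1) (y k); move: (halpern_step k).
move: (y k) (y k.+1) (g (y k)) (g (y k.+1)) => yk y1 g0 g1 ->.
rewrite !(ipE inn) (ipC inn g0 g1) -subr_ge0 => mono.
have n0 : 0 <= k.+1%:R * k.+2%:R :> R by rewrite mulr_ge0.
have gap := mulr_ge0 n0 mono; rewrite -subr_ge0; apply: le_trans gap _.
rewrite le_eqVlt; apply/orP; left; apply/eqP.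
have k2 : k%:R + 1 + 1 != 0 :> R by rewrite !natr1 pnatr_eq0.
by rewrite -!natr1; field.
Qed.

(** Adding E K <= 0, divided by K+1, to monotonicity between (J y_K, g y_K) and (z, 0) gives
    (K+1)|g|^2 <= <g, y_0 - z>; Cauchy-Schwarz concludes. *)
Lemma halpern_residual K :
  final_residual ip M y0 K (halpern V) <= hnorm ip (y0 - z) / K.+1%:R.
Proof.
rewrite ler_pdivlMr ?ltr0n// mulrC.
have -> : final_residual ip M y0 K (halpern V) = hnorm ip (g (y K)).
  by rewrite /final_residual /residual hnormBC.
have key : K.+1%:R * ip (g (y K)) (g (y K)) <= ip (g (y K)) (y0 - z).
  have mem : M (J (y K)) (g (y K)) by apply: resolvent_mem M_instance _ _; exists z, 0.
  have : 0 <= ip (J (y K) - z) (g (y K) - 0) by case: M_instance => _ [+ _]; apply.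
  have := halpern_potential K; rewrite /E resolvent_residual subr0 -natr1.
  move: (y K) (g (y K)) => yK G; rewrite !(ipE inn) !(ipC inn _ G) => le1 le2.
  have : (K%:R + 1) * (K%:R * ip G G + (ip G yK - ip G y0)) <= 0 by lra.
  by rewrite pmulr_rle0 ?ltr_wpDl//; lra.
set N := hnorm ip (g (y K)).
have : N * (K.+1%:R * N) <= N * hnorm ip (y0 - z).
  by apply: le_trans (ip_le_hnorm inn _ _); rewrite mulrCA -expr2 hnorm_sqr.
have [->|N0] := eqVneq N 0; first by rewrite mulr0 hnorm_ge0.
by rewrite ler_pM2l// lt_def N0 hnorm_ge0.
Qed.

End Halpern.

(** * The bound d_0 / (K+1) on every instance *)

Section UpperBound.
Variables (R : realType) (V : lmodType R) (ip : V -> V -> R).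

Lemma final_residual_lb M y0 K : has_lbound (range (final_residual ip M y0 K)).
Proof. by exists 0 => _ [m _ <-]; exact: hnorm_ge0. Qed.

Lemma minimax_le M y0 K m : minimax ip M y0 K <= final_residual ip M y0 K m.
Proof. by apply: ge_inf; [exact: final_residual_lb|exists m]. Qed.

Lemma minimax_ge M y0 K r : (forall m, r <= final_residual ip M y0 K m) ->
  r <= minimax ip M y0 K.
Proof.
move=> h; apply: lb_le_inf; first by exists (final_residual ip M y0 K (halpern V)), (halpern V).
by move=> _ [m _ <-].
Qed.

Lemma minimax_le_dist M y0 K : is_instance ip M -> zeros M !=set0 ->
  minimax ip M y0 K <= dist_zeros ip M y0 / K.+1%:R.
Proof.
move=> MI [z0 Mz0]; rewrite ler_pdivlMr ?ltr0n//; apply: lb_le_inf.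
  by exists (hnorm ip (y0 - z0)), z0.
move=> _ [z Mz <-]; rewrite -ler_pdivlMr ?ltr0n//.
exact: le_trans (minimax_le _ _ _ (halpern V)) (halpern_residual MI _ Mz K).
Qed.

Lemma minimax_dist1 M y0 K : is_instance ip M -> dist_zeros ip M y0 = 1 ->
  minimax ip M y0 K <= K.+1%:R^-1.
Proof.
move=> MI d1.
have zerosN : zeros M !=set0.
  apply/set0P/eqP => zeros0; move: d1; rewrite /dist_zeros zeros0 image_set0 inf0.
  by move/eqP; rewrite eq_sym oner_eq0.
by have := minimax_le_dist y0 K MI zerosN; rewrite d1 mul1r.
Qed.

End UpperBound.

(** * Block spaces *)

Section MaximalMonotone.
Variables (R : realType) (V : lmodType R) (ip : V -> V -> R) (M : V -> set V).
Hypotheses (ip_inner : inner_product ip) (M_monotone : Defs.monotone ip M).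

Lemma ip_eq0 x : ip x x <= 0 -> x = 0.
Proof.
move=> x0; apply/eqP; apply: contraTT x0 => x0; rewrite -ltNge.
by case: ip_inner => _ _; apply.
Qed.

Lemma monotone_resolvent_uniq x x' u u' :
  M x u -> M x' u' -> x + u = x' + u' -> x = x'.
Proof.
move=> Mx Mx' /(canRL (addKr _)) uE; apply/eqP; rewrite -subr_eq0; apply/eqP/ip_eq0.
have := M_monotone Mx Mx'; rewrite uE.
have -> : - x + (x' + u') - u' = - (x - x') by rewrite addrA addrK opprB addrC.
by rewrite (ipNr ip_inner) oppr_ge0.
Qed.

Lemma resolventE x y : M x (y - x) -> resolvent M y = x.
Proof.
move=> Mx; have := @xgetPex _ 0 [set x | M x (y - x)] (ex_intro _ x Mx).
by move=> /= Mr; apply: (monotone_resolvent_uniq Mr Mx); rewrite !subrKC.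
Qed.

End MaximalMonotone.

(** Converse of Minty's theorem: if a monotone extension contains (x, u), the solution that [M]
    provides for x + u must be [x] by uniqueness in the extension, so (x, u) is already in [M]. *)
Lemma maximal_monotone_surj (R : realType) (V : lmodType R) (ip : V -> V -> R)
    (M : V -> set V) : inner_product ip -> Defs.monotone ip M ->
  (forall y, exists x, M x (y - x)) -> maximal_monotone ip M.
Proof.
move=> inn mon surj; split=> // M' mon' sub x u M'x.
have [x' Mx'] := surj (x + u).
have xE : x = x'.
  by apply: (monotone_resolvent_uniq inn mon' M'x (sub _ _ Mx')); rewrite subrKC.
by move: Mx'; rewrite -xE addrC addKr.
Qed.

(** * The Hilbert space of blocks *)

Section BlockSpace.
Variables (R : realType) (n : nat).
Implicit Types (x y : blocks R n) (z w : Rcomplex R).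

Lemma ip_blockxx z : ip_block z z = Normc.normc z ^+ 2.
Proof. by case: z => a b; rewrite /ip_block/= sqr_sqrtr ?addr_ge0 ?sqr_ge0// !expr2. Qed.

Lemma ip_blocks_inner : inner_product (@ip_blocks R n).
Proof.
split=> [x y|a x y z|x x0].
- by apply: eq_bigr => j _; rewrite /ip_block; ring.
- rewrite /ip_blocks mulr_sumr -big_split; apply: eq_bigr => j _.
  by rewrite !ffunE /ip_block; case: (x j) (y j) (z j) => [? ?] [? ?] [? ?] /=; ring.
have [j xj] : exists j, x j != 0.
  apply/existsP; apply: contraNT x0; rewrite negb_exists => /forallP x0.
  by apply/eqP/ffunP => j; rewrite ffunE; apply/eqP; have := x0 j; rewrite negbK.
rewrite /ip_blocks (bigD1 j)//= ltr_wpDr ?sumr_ge0// => [i _|];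
  rewrite ip_blockxx ?sqr_ge0// exprn_gt0// lt_def.
apply/andP; split; last by case: (x j) => *; exact: sqrtr_ge0.
by apply: contra xj => /eqP/Normc.eq0_normc ->.
Qed.

Lemma hnorm_blocks_sqr x : hnorm ip_blocks x ^+ 2 = \sum_j Normc.normc (x j) ^+ 2.
Proof. by rewrite (hnorm_sqr ip_blocks_inner); apply: eq_bigr => j _; rewrite ip_blockxx. Qed.

Lemma normc_le_hnorm x j : Normc.normc (x j) <= hnorm ip_blocks x.
Proof.
rewrite -(@ler_pXn2r _ 2) ?nnegrE ?hnorm_ge0//; last by case: (x j) => *; exact: sqrtr_ge0.
by rewrite hnorm_blocks_sqr (bigD1 j)//= lerDl sumr_ge0// => i _; rewrite sqr_ge0.
Qed.

Lemma normRe_le_normc z : `|complex.Re z| <= Normc.normc z.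
Proof. by case: z => a b /=; rewrite -sqrtr_sqr ler_wsqrtr// lerDl sqr_ge0. Qed.

Lemma normIm_le_normc z : `|complex.Im z| <= Normc.normc z.
Proof. by case: z => a b /=; rewrite -sqrtr_sqr ler_wsqrtr// lerDr sqr_ge0. Qed.

Lemma cauchy_real_cvg (u : nat -> R) :
  (forall e, 0 < e -> exists N : nat, forall p q : nat,
     (N <= p)%N -> (N <= q)%N -> `|u p - u q| < e) ->
  cvgn u.
Proof.
move=> h; apply/cauchy_cvgP/cauchy_exP => e /= /h [N hN].
by exists (u N), N => // k /= Nk; exact: hN.
Qed.

Lemma cvg_sum_seq (I : Type) (s : seq I) (f : I -> nat -> R) (l : I -> R) :
  (forall i, f i @ \oo --> l i) ->
  (fun k => \sum_(i <- s) f i k) @ \oo --> \sum_(i <- s) l i.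
Proof.
move=> h; elim: s => [|i s IH].
  by rewrite big_nil; under eq_fun do rewrite big_nil; exact: cvg_cst.
by rewrite big_cons; under eq_fun do rewrite big_cons; exact: cvgD.
Qed.

Lemma ip_blocks_complete : norm_complete (@ip_blocks R n).
Proof.
move=> u cau.
have cvgRe j : cvgn (fun k => complex.Re (u k j)).
  apply: cauchy_real_cvg => e /cau [N hN]; exists N => p q Np Nq.
  apply: le_lt_trans (hN p q Np Nq); apply: le_trans (normc_le_hnorm _ j).
  by apply: le_trans (normRe_le_normc _); rewrite !ffunE; case: (u p j) (u q j) => [? ?] [].
have cvgIm j : cvgn (fun k => complex.Im (u k j)).
  apply: cauchy_real_cvg => e /cau [N hN]; exists N => p q Np Nq.
  apply: le_lt_trans (hN p q Np Nq); apply: le_trans (normc_le_hnorm _ j).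
  by apply: le_trans (normIm_le_normc _); rewrite !ffunE; case: (u p j) (u q j) => [? ?] [].
pose l : blocks R n := [ffun j => Complex (limn (fun k => complex.Re (u k j)))
                                          (limn (fun k => complex.Im (u k j)))].
exists l => e e0.
have : (fun k => ip_blocks (u k - l) (u k - l)) @ \oo --> \sum_(j < n) (0 : R).
  apply: cvg_sum_seq => j.
  set a := limn (fun k => complex.Re (u k j)); set b := limn (fun k => complex.Im (u k j)).
  have -> : 0 = (a - a) * (a - a) + (b - b) * (b - b) by rewrite !subrr !mulr0 addr0.
  have -> : (fun k => ip_block ((u k - l) j) ((u k - l) j)) =
      (fun k => (complex.Re (u k j) - a) * (complex.Re (u k j) - a) +
                (complex.Im (u k j) - b) * (complex.Im (u k j) - b)).
    by apply: funext => k; rewrite /ip_block !ffunE -/a -/b; case: (u k j).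
  by apply: cvgD; apply: cvgM; apply: cvgB;
    (exact: cvg_cst || exact: cvgRe || exact: cvgIm).
rewrite big1// => /cvgr_lt /(_ (e ^+ 2)); rewrite exprn_gt0// => /(_ isT) [N _ hN].
exists N => k Nk; rewrite -(@ltr_pXn2r _ 2) ?nnegrE ?hnorm_ge0 ?ltW//.
by rewrite (hnorm_sqr ip_blocks_inner); exact: hN.
Qed.

End BlockSpace.

(** * Diagonal operators: spectrum and methods *)

Local Open Scope complex_scope.

Section DiagonalSpectrum.
Variables (R : realType) (n : nat) (d : 'I_n -> R[i]) (L : blocks R n -> blocks R n).
Hypothesis L_diag : forall x j, L x j = d j * x j.
Hypothesis d_conj : forall j, exists j', d j' = (d j)^*.
Implicit Types (x y : blocks R n) (p q : blocks R n * blocks R n) (z : R[i]).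

Let F z p := complexify L p - Defs.cscale z p.

Lemma scale_rcomplex (a : R) (w : Rcomplex R) : a *: w = a%:C * (w : R[i]) :> R[i].
Proof. by case: w => b c; simpc. Qed.

Lemma mul_ii : 'i * 'i = -1 :> R[i]. Proof. exact: sqr_i. Qed.

(* In the coordinates [p.1 + i p.2] and [p.1 - i p.2] of the complexification of
   the plane, [L - z] is multiplication by [d j - z] and by [d j - z^*]. *)
Lemma shift_plus z p j :
  ((F z p).1 j : R[i]) + 'i * (F z p).2 j = (d j - z) * ((p.1 j : R[i]) + 'i * p.2 j).
Proof.
rewrite /F /complexify /Defs.cscale /= !ffunE !L_diag.
case: (d j) (p.1 j) (p.2 j) z => [a b] [u v] [w t] [e f].
by apply/eqP; rewrite eq_complex; apply/andP; split; apply/eqP => /=; ring.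
Qed.

Lemma shift_minus z p j :
  ((F z p).1 j : R[i]) - 'i * (F z p).2 j = (d j - z^*) * ((p.1 j : R[i]) - 'i * p.2 j).
Proof.
rewrite /F /complexify /Defs.cscale /= !ffunE !L_diag.
case: (d j) (p.1 j) (p.2 j) z => [a b] [u v] [w t] [e f].
by apply/eqP; rewrite eq_complex; apply/andP; split; apply/eqP => /=; ring.
Qed.

Lemma plus_minus_inj p q :
  (forall j, (p.1 j : R[i]) + 'i * p.2 j = (q.1 j : R[i]) + 'i * q.2 j) ->
  (forall j, (p.1 j : R[i]) - 'i * p.2 j = (q.1 j : R[i]) - 'i * q.2 j) ->
  p = q.
Proof.
move=> hp hm.
have half_sum (u v : R[i]) : u = ((u + v) + (u - v)) / 2 by field.
have half_diff (u v : R[i]) : v = ((u + v) - (u - v)) / 2 by field.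
have E1 j : (p.1 j : R[i]) = q.1 j.
  by rewrite (half_sum (p.1 j) ('i * p.2 j)) hp hm -half_sum.
have E2 j : (p.2 j : R[i]) = q.2 j.
  have : 'i * (p.2 j : R[i]) = 'i * q.2 j.
    by rewrite (half_diff (p.1 j) ('i * p.2 j)) hp hm -half_diff.
  by move/(congr1 ( *%R (- 'i))); rewrite !mulrA mulNr mul_ii opprK !mul1r.
by case: p q {hp hm} E1 E2 => p1 p2 [q1 q2] /= E1 E2; congr pair; apply/ffunP.
Qed.

(** The inverse divides the two coordinates by [d j - z] and by [d j - conj z]; the second divisor
    is nonzero because the values of [d] are closed under conjugation. *)
Lemma shift_bijective z : (forall j, d j != z) -> bijective (F z).
Proof.
move=> dz.
have dzc j : d j != z^*.
  apply/eqP => djz; have [j' dj'] := d_conj j.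
  by move/eqP: (dz j'); rewrite dj' djz conjcK.
pose s q j : R[i] := ((q.1 j : R[i]) + 'i * q.2 j) / (d j - z).
pose t q j : R[i] := ((q.1 j : R[i]) - 'i * q.2 j) / (d j - z^*).
pose G q : blocks R n * blocks R n :=
  ([ffun j => (s q j + t q j) / 2], [ffun j => - 'i * (s q j - t q j) / 2]).
have Gp q j : ((G q).1 j : R[i]) + 'i * (G q).2 j = s q j.
  rewrite !ffunE.
  have -> : 'i * (- 'i * (s q j - t q j) / 2) = - ('i * 'i) * (s q j - t q j) / 2.
    by ring.
  by rewrite mul_ii; field.
have Gm q j : ((G q).1 j : R[i]) - 'i * (G q).2 j = t q j.
  rewrite !ffunE.
  have -> : 'i * (- 'i * (s q j - t q j) / 2) = - ('i * 'i) * (s q j - t q j) / 2.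
    by ring.
  by rewrite mul_ii; field.
exists G => q; apply: plus_minus_inj => j.
- by rewrite Gp /s shift_plus mulrC mulKf// subr_eq0.
- by rewrite Gm /t shift_minus mulrC mulKf// subr_eq0.
- by rewrite shift_plus Gp mulrC divfK// subr_eq0.
- by rewrite shift_minus Gm mulrC divfK// subr_eq0.
Qed.

Lemma diag_eigenvalue j : eigenvalues L (d j).
Proof.
(* For this vector [p.1 - i p.2] vanishes and [p.1 + i p.2] is supported on block [j]. *)
exists ([ffun i => (i == j)%:R], [ffun i => - 'i * (i == j)%:R]).
  apply/eqP => /(congr1 (fun p => p.1 j)); rewrite !ffunE eqxx.
  by move/eqP; rewrite oner_eq0.
apply/eqP; rewrite -subr_eq0; apply/eqP.
apply: plus_minus_inj => i.
  rewrite (shift_plus (d j)) !ffunE; case: eqP => [->|_]; first by rewrite subrr mul0r mulr0 addr0.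
  by rewrite !mulr0 !addr0 mulr0.
rewrite (shift_minus (d j)) !ffunE; case: eqP => [->|_].
  by rewrite mulr1 mulrN mul_ii opprK subrr !mulr0 subrr.
by rewrite !mulr0 !subr0 mulr0.
Qed.

Lemma eigenvalue_spectrum z : eigenvalues L z -> spectrum L z.
Proof.
move=> [p p0 pE] /bij_inj inj; move/eqP: p0; apply; apply: inj.
rewrite pE subrr /complexify /Defs.cscale /= !scaler0 subr0 addr0.
rewrite (_ : L 0 = 0) ?subr0//.
by apply/ffunP => j; rewrite L_diag ffunE mulr0.
Qed.

Lemma spectrum_diag : spectrum L = range d.
Proof.
apply/seteqP; split=> z; last by move=> [j _ <-]; exact/eigenvalue_spectrum/diag_eigenvalue.
move=> nbij; apply: contrapT => nrange; apply/nbij/shift_bijective => j.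
by apply/eqP => dz; apply: nrange; exists j.
Qed.

Lemma eigenvalues_diag : eigenvalues L = range d.
Proof.
apply/seteqP; split=> z; last by move=> [j _ <-]; exact: diag_eigenvalue.
by move=> /eigenvalue_spectrum; rewrite spectrum_diag.
Qed.

End DiagonalSpectrum.

Lemma floor_diag (R : realType) (n : nat) (d : 'I_n -> R[i])
    (L : blocks R n -> blocks R n) (j0 : 'I_n) :
  (forall x j, L x j = d j * x j) -> (forall j, exists j', d j' = (d j)^*) ->
  (forall j, Normc.normc (1 - d j0) <= Normc.normc (1 - d j)) ->
  floor_of L = Normc.normc (1 - d j0).
Proof.
move=> L_diag d_conj d_min; rewrite /floor_of (spectrum_diag L_diag d_conj).
apply/eqP; rewrite eq_le; apply/andP; split.
  by apply: ge_inf; [exists (Normc.normc (1 - d j0)) => _ [_ [j _ <-] <-]|exists (d j0)].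
by apply: lb_le_inf; [exists (Normc.normc (1 - d j0)), (d j0)|move=> _ [_ [j _ <-] <-]].
Qed.

(** * Methods as real polynomials *)

Section DiagonalMethods.
Variables (R : realType) (n : nat) (omega : 'I_n -> R[i]) (L : blocks R n -> blocks R n).
Hypothesis L_diag : forall x j, L x j = (1 + omega j) / 2%:R * x j.

Let eval (P : {poly R}) j := (map_poly (real_complex R) P).[omega j].

(** The variable is omega rather than the eigenvalue (1 + omega) / 2; this affine change fixes 1, so
    it preserves the degree bound and the normalization at 1. *)
Definition krylov (y0 : blocks R n) k (x : blocks R n) : Prop :=
  exists P : {poly R}, [/\ (size P <= k.+1)%N, P.[1] = 1 &
    forall j, x j = eval P j * y0 j].

Lemma krylov_combination y0 k (c : nat -> R) (h : seq (blocks R n)) :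
  \sum_(i < size h) c i = 1 -> (forall i, (i < size h)%N -> krylov y0 k h`_i) ->
  krylov y0 k (combination c h).
Proof.
move=> c1 hK.
have /choice[P hP] : forall i : 'I_(size h), exists P : {poly R},
    [/\ (size P <= k.+1)%N, P.[1] = 1 & forall j, h`_i j = eval P j * y0 j].
  by move=> i; exact: hK.
exists (\sum_(i < size h) c i *: P i); split.
- apply: (leq_trans (size_sum _ _ _)); apply/bigmax_leqP => i _.
  by apply: (leq_trans (size_scale_leq _ _)); case: (hP i).
- rewrite horner_sum -[RHS]c1; apply: eq_bigr => i _.
  by rewrite hornerZ; case: (hP i) => _ -> _; rewrite mulr1.
move=> j; rewrite /combination sum_ffunE /eval rmorph_sum horner_sum mulr_suml.
apply: eq_bigr => i _; rewrite ffunE scale_rcomplex; case: (hP i) => _ _ -> /=.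
by rewrite map_polyZ hornerZ mulrA.
Qed.

Lemma krylov_resolvent y0 k x : krylov y0 k x -> krylov y0 k.+1 (L x).
Proof.
move=> [P [sP P1 xE]]; exists (2^-1 *: (P + P * 'X)); split.
- apply: (leq_trans (size_scale_leq _ _)); apply: (leq_trans (size_polyD _ _)).
  rewrite geq_max (leq_trans sP)//=; apply: leq_trans (size_polyMleq _ _) _.
  by rewrite size_polyX addn2.
- by rewrite hornerZ hornerD hornerMX P1 mulr1; field.
move=> j; rewrite L_diag xE /eval map_polyZ rmorphD rmorphM /= map_polyX.
rewrite hornerZ hornerD hornerMX fmorphV rmorph_nat; ring.
Qed.

Lemma krylov_mono y0 k k' x : (k <= k')%N -> krylov y0 k x -> krylov y0 k' x.
Proof. by move=> kk' [P [sP P1 xE]]; exists P; split=> //; exact: leq_trans sP _. Qed.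

Lemma krylov_start y0 : krylov y0 0 y0.
Proof.
exists 1; split; rewrite ?size_poly1 ?hornerC// => j.
by rewrite /eval rmorph1 hornerC mul1r.
Qed.

Lemma krylov_history m y0 k i : (i < k.+1)%N -> krylov y0 k (history m L y0 k)`_i.
Proof.
elim: k i => [|k IH] i.
  by rewrite ltnS leqn0 => /eqP ->; exact: krylov_start.
rewrite ltnS history_last nth_rcons size_history leq_eqVlt => /predU1P[->|ik].
  rewrite ltnn eqxx; apply/krylov_resolvent/krylov_combination.
    by apply: query_coef_sum1; rewrite size_history.
  by move=> j; rewrite size_history => /IH.
by rewrite ik; apply: krylov_mono (IH _ ik).
Qed.

Lemma krylov_iterate m y0 k : krylov y0 k (iterate m L y0 k).
Proof.
case: k => [|k]; first exact: krylov_start.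
apply: krylov_combination; first by apply: output_coef_sum1; rewrite size_rcons.
by move=> i; rewrite size_rcons size_history => /krylov_history.
Qed.

(** A nonadaptive method suffices: always querying the last evaluation makes the history y_0, L y_0,
    L^2 y_0, ..., and the output takes the coefficients of [Q] in powers of the eigenvalue. *)
Lemma method_of_poly (K : nat) (Q : {poly R}) (y0 : blocks R n) :
  (size Q <= K.+2)%N -> Q.[1] = 1 ->
  exists m, forall j, iterate m L y0 K.+1 j = eval Q j * y0 j.
Proof.
move=> sQ Q1; pose Q' := Q \Po (2 *: 'X - 1).
pose last_coef (s i : nat) : R := (i == s.-1)%:R.
(* The output after K+1 steps reads K+2 entries; at other sizes any sum-one coefficients serve. *)
pose out (s i : nat) := if s == K.+2 then Q'`_i else last_coef s i.
have last1 h : (0 < size h)%N -> \sum_(i < size h) last_coef (size h) i = 1.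
  case: h => // x h _ /=; rewrite big_ord_recr /= /last_coef eqxx big1 ?add0r// => i _.
  by rewrite ltn_eqF.
have sQ' : (size Q' <= K.+2)%N.
  apply: leq_trans (size_comp_poly_leq _ _) _.
  have s2 : (size (2 *: 'X - 1 : {poly R})%R <= 2)%N.
    apply: leq_trans (size_polyD _ _) _; rewrite size_polyN size_poly1 geq_max andbT.
    by apply: leq_trans (size_scale_leq _ _) _; rewrite size_polyX.
  rewrite ltnS; apply: leq_trans (leq_mul (_ : _ <= K.+1) (_ : _ <= 1))%N _; last by rewrite muln1.
    by rewrite -ltnS; case: (size Q) sQ.
  by rewrite -ltnS; case: (size _) s2.
have out1 h : (0 < size h)%N -> \sum_(i < size h) out (size h) i = 1.
  move=> h0; rewrite /out; case: eqP => [->|_]; last exact: last1.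
  rewrite -(_ : Q'.[1] = 1).
    by rewrite (horner_coef_wide _ sQ'); apply: eq_bigr => i _; rewrite expr1n mulr1.
  by rewrite horner_comp !hornerE; rewrite -[RHS]Q1; congr Q.[_]; ring.
exists (@Method R _ (fun h => last_coef (size h)) (fun h => out (size h))
                (fun h => @last1 _ h) (fun h => @out1 _ h)).
set m := Method _ _; move=> j.
have hist k : forall i, (i <= k)%N -> (history m L y0 k)`_i j = ((1 + omega j) / 2) ^+ i * y0 j.
  elim: k => [|k IH] i; first by rewrite leqn0 => /eqP -> /=; rewrite mul1r.
  rewrite leq_eqVlt history_last nth_rcons size_history => /predU1P[->|ik]; last by rewrite ik IH.
  rewrite ltnn eqxx L_diag.
  suff -> : combination (query_coef m (history m L y0 k)) (history m L y0 k) =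
     (history m L y0 k)`_k by rewrite IH// exprS mulrA.
  rewrite /combination /= size_history big_ord_recr /= /last_coef eqxx scale1r big1 ?add0r// => l _.
  by rewrite ltn_eqF// scale0r.
have -> : iterate m L y0 K.+1 =
    combination (out (size (history m L y0 K.+1))) (history m L y0 K.+1) by [].
rewrite /combination sum_ffunE size_history /out eqxx.
have -> : eval Q j = (map_poly (real_complex R) Q').[(1 + omega j) / 2].
  rewrite /Q' map_comp_poly horner_comp rmorphB /= map_polyZ map_polyX rmorph1 rmorph_nat.
  by rewrite hornerD hornerZ hornerX hornerN hornerC (_ : 2 * _ - 1 = omega j)//; field.
rewrite (horner_coef_wide _ (leq_trans (size_poly _ _) sQ')) mulr_suml.
apply: eq_bigr => i _; rewrite ffunE scale_rcomplex hist; last by rewrite -ltnS.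
by rewrite coef_map mulrA.
Qed.

End DiagonalMethods.

(** * Skew blocks *)

Section Expi.
Variable R : realType.
Implicit Types (s t : R).

Definition expi t : R[i] := cos t +i* sin t.

Lemma expi0 : expi 0 = 1. Proof. by rewrite /expi cos0 sin0. Qed.

Lemma expiD s t : expi (s + t) = expi s * expi t.
Proof.
by apply/eqP; rewrite eq_complex /= cosD sinD [sin s * _ + _]addrC !eqxx.
Qed.

Lemma conjc_expi t : (expi t)^* = expi (- t).
Proof. by rewrite /expi cosN sinN. Qed.

Lemma expiXn t k : expi t ^+ k = expi (t *+ k).
Proof. by elim: k => [|k IH]; rewrite ?expi0// exprS IH mulrS expiD. Qed.

Lemma normc_expi t : Normc.normc (expi t) = 1.
Proof. by rewrite /= cos2Dsin2 sqrtr1. Qed.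

Lemma expi2pi k : expi (pi *+ 2 *+ k) = 1.
Proof. by rewrite -expiXn /expi cos2pi sin2pi expr1n. Qed.

(** From cos t = 1 - 2 sin^2 (t/2) one gets sin (t/2) = 0, where |t/2| < pi. *)
Lemma expi_eq1 t : - (pi *+ 2) < t -> t < pi *+ 2 -> expi t = 1 -> t = 0.
Proof.
move=> t1 t2 /(congr1 (@complex.Re _)) /= cos1.
have : sin (t / 2) = 0.
  have : cos (t / 2 + t / 2) = 1 by rewrite -splitr.
  rewrite cosD => c; have := cos2Dsin2 (t / 2) => cs.
  have /eqP : sin (t / 2) ^+ 2 = 0 by rewrite expr2 in cs *; lra.
  by rewrite sqrf_eq0 => /eqP.
move=> s0; apply/eqP/negPn/negP => tn0.
have [tlt|tgt] := ltrP t 0.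
  have : 0 < sin (- (t / 2)) by apply: sin_gt0_pi; rewrite mulr2n in t1; lra.
  by rewrite sinN s0 oppr0 ltxx.
have tpos : 0 < t by rewrite lt_def tn0.
have : 0 < sin (t / 2) by apply: sin_gt0_pi; rewrite mulr2n in t2; lra.
by rewrite s0 ltxx.
Qed.

Lemma sum_expi N t : - (pi *+ 2) < t -> t < pi *+ 2 -> t != 0 ->
  expi t ^+ N = 1 -> \sum_(k < N) expi t ^+ k = 0.
Proof.
move=> t1 t2 t0 tN; have := subrX1 (expi t) N; rewrite tN subrr => /esym/eqP.
by rewrite mulf_eq0 subr_eq0 => /orP[/eqP/(expi_eq1 t1 t2) /eqP|/eqP//]; rewrite (negPf t0).
Qed.

(** Both sides equal cos t e^{-it}: the eigenvalue lies on the circle with diameter [0, 1]. *)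
Lemma half_turn_resolvent t : cos t != 0 ->
  (1 + (tan t)*i)^-1 = (1 + expi (- (t *+ 2))) / 2%:R.
Proof.
move=> ct; have c0 : 1 + (tan t)*i != 0 :> R[i] by rewrite eq_complex /= addr0 oner_eq0.
have two0 : 2%:R != 0 :> R[i] by rewrite pnatr_eq0.
apply: (mulfI c0); rewrite mulfV//; apply: (mulIf two0); rewrite mul1r -mulrA divfK//.
have := cos2Dsin2 t; rewrite mulr2n opprD expiD /expi cosN sinN /tan => cs.
apply/eqP; rewrite eq_complex /=; apply/andP; split; apply/eqP.
  rewrite [RHS](_ : _ = 1 + (cos t ^+ 2 + sin t ^+ 2));
    last by field.
  by rewrite cs.
rewrite [RHS](_ : _ = sin t / cos t * (1 - (cos t ^+ 2 + sin t ^+ 2))); last by field.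
by rewrite cs subrr mulr0 addr0.
Qed.

End Expi.

Section SkewBlocks.
Variables (R : realType) (n : nat) (vertical : 'I_n -> bool) (slope : 'I_n -> R).

(** Common form of the blocks of both instances; a vertical block is the case of infinite slope. *)
Definition skew_block j (z : Rcomplex R) : set (Rcomplex R) :=
  if vertical j then normal_cone [set 0] z else [set (slope j)*i * z].

Let M : blocks R n -> set (blocks R n) := direct_sum skew_block.
Let d j : R[i] := if vertical j then 0 else (1 + (slope j)*i)^-1.

Lemma skew_monotone : Defs.monotone ip_blocks M.
Proof.
move=> x y u v Mx My; apply: sumr_ge0 => j _.
have := Mx j; have := My j; rewrite /skew_block !ffunE.
case: (vertical j) => [[y0 _] [x0 _]|-> ->].
  by rewrite x0 y0 subrr /ip_block /= !mul0r addr0.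
by rewrite /ip_block; case: (x j) (y j) => [a b] [e f] /=; nra.
Qed.

Lemma slope_neq0 j : 1 + (slope j)*i != 0 :> R[i].
Proof. by rewrite eq_complex /= addr0 oner_eq0. Qed.

Lemma skew_surj (y : blocks R n) : M [ffun j => d j * y j] (y - [ffun j => d j * y j]).
Proof.
move=> j; rewrite /skew_block !ffunE /d; case: ifP => vj.
  rewrite vj; have -> : 0 * y j = 0 :> Rcomplex R by exact: mul0r.
  by split=> // z ->; rewrite /ip_block subrr /= !mulr0 addr0.
rewrite vj; have := slope_neq0 j; move: (slope j)*i (y j : R[i]) => c w c0 /=.
by field.
Qed.

Lemma skew_instance : is_instance ip_blocks M.
Proof.
split; first by split; [exact: ip_blocks_inner|exact: ip_blocks_complete].
apply: maximal_monotone_surj; [exact: ip_blocks_inner|exact: skew_monotone|].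
by move=> y; eexists; exact: skew_surj.
Qed.

Lemma skew_resolvent x j : resolvent M x j = d j * x j.
Proof.
by rewrite (resolventE (@ip_blocks_inner R n) skew_monotone (skew_surj x)) ffunE.
Qed.

Lemma skew_zeros : (forall j, ~~ vertical j -> slope j != 0) -> zeros M = [set 0].
Proof.
move=> slope0; apply/seteqP; split=> [x Mx|_ ->] /=.
  apply/ffunP => j; have := Mx j; have := slope0 j; rewrite /skew_block !ffunE.
  case: (vertical j) => [_ []//|/(_ isT) sj /esym/eqP]; rewrite mulf_eq0 => /orP[|/eqP//].
  by rewrite eq_complex /= (negPf sj) andbF.
move=> j; rewrite /skew_block !ffunE; case: ifP => _; last by rewrite /= mulr0.
by split=> // z ->; rewrite /ip_block /= !mul0r addr0.
Qed.

End SkewBlocks.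

(** * The extremal instance *)

Section NormC.
Variable R : realType.
Implicit Types z w : R[i].

Lemma normc_sqrC z : (Normc.normc z ^+ 2)%:C = z * z^*.
Proof.
case: z => a b; rewrite /= sqr_sqrtr ?addr_ge0 ?sqr_ge0//.
by apply/eqP; rewrite eq_complex /=; apply/andP; split; apply/eqP; ring.
Qed.

Lemma conj_real (a : R) : conjc a%:C = a%:C.
Proof. by rewrite /= oppr0. Qed.

Lemma normc_real (a : R) : 0 <= a -> Normc.normc a%:C = a.
Proof. by move=> a0; rewrite /= expr0n addr0 sqrtr_sqr ger0_norm. Qed.

Lemma normc_sum (I : finType) (f : I -> R[i]) :
  Normc.normc (\sum_i f i) <= \sum_i Normc.normc (f i).
Proof.
elim/big_ind2: _ => [|a z b w za wb|//]; first by rewrite Normc.normc0.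
by apply: le_trans (le_normcD z w) _; exact: lerD.
Qed.

Lemma normc_sub1_expi (t : R) :
  Normc.normc (1 - (1 + expi t) / 2%:R) = `|sin (t / 2)|.
Proof.
have -> : 1 - (1 + expi t) / 2%:R = (2^-1)%:C * (1 - expi t).
  by rewrite fmorphV rmorph_nat; field.
rewrite Normc.normcM normc_real ?invr_ge0//.
have -> : expi t = expi (t / 2 + t / 2) by rewrite -splitr.
rewrite /= add0r -[RHS]sqrtr_sqr.
rewrite -[X in X * _]ger0_norm ?invr_ge0// -[X in X * _]sqrtr_sqr -sqrtrM ?sqr_ge0//.
congr Num.sqrt.
rewrite sqrrN cosD sinD; have := cos2Dsin2 (t / 2) => cs.
have -> : cos (t / 2) * cos (t / 2) - sin (t / 2) * sin (t / 2) = 1 - 2 * sin (t / 2) ^+ 2.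
  by rewrite -!expr2; lra.
have -> : (sin (t / 2) * cos (t / 2) + cos (t / 2) * sin (t / 2)) ^+ 2 =
  4 * sin (t / 2) ^+ 2 * (1 - sin (t / 2) ^+ 2).
  by rewrite [1 - _](_ : _ = cos (t / 2) ^+ 2); [ring|lra].
by field.
Qed.

(** Isolates the weights (|1 - d_j| |y_0j|)^2, which become 1/n^2 for the extremal instance and sin
    theta_j / Lambda for the rotation instance. *)
Lemma hnorm_diag (n : nat) (d : 'I_n -> R[i]) (L : blocks R n -> blocks R n)
    (y0 x : blocks R n) (c : 'I_n -> R[i]) :
  (forall x j, L x j = d j * x j) -> (forall j, x j = c j * y0 j) ->
  hnorm ip_blocks (L x - x) ^+ 2 =
  \sum_j (Normc.normc (1 - d j) * Normc.normc (y0 j)) ^+ 2 * Normc.normc (c j) ^+ 2.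
Proof.
move=> L_diag xE; rewrite hnorm_blocks_sqr; apply: eq_bigr => j _.
have -> : (L x - x) j = - ((1 - d j) * c j * y0 j) :> R[i].
  by rewrite !ffunE L_diag xE; ring.
rewrite (normcN (_ : Rcomplex R)) !Normc.normcM -!exprMn; congr (_ ^+ 2); ring.
Qed.

Lemma dist_zeros_single (V : lmodType R) (ip : V -> V -> R) M y0 :
  zeros M = [set 0] -> dist_zeros ip M y0 = hnorm ip y0.
Proof. by move=> M0; rewrite /dist_zeros M0 image_set1 subr0 inf1. Qed.

End NormC.

Lemma sin_pi_sub (R : realType) (a : R) : sin (pi - a) = sin a.
Proof. by rewrite sinB sinpi cospi mul0r mulN1r sub0r opprK. Qed.

Lemma sin_min (R : realType) (a b : R) :
  0 < a -> a <= b -> b <= pi - a -> sin a <= sin b.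
Proof.
move=> a0; wlog : b / b <= pi / 2 => [H ab bpi|b2].
  have [|b2] := lerP b (pi / 2); first by move=> b2; exact: H.
  by rewrite -(sin_pi_sub b); apply: H; lra.
rewrite le_eqVlt => /predU1P[->//|ab] bpi; apply/ltW.
by rewrite ltr_sin// in_itv /=; apply/andP; split; lra.
Qed.

Section ExtremalInstance.
Variables (R : realType) (K : nat).
Implicit Type j : 'I_K.+1.

Let vertical j := phi j == pi :> R.
Let slope j : R := - tan (phi j / 2%:R).

Lemma extremal_skew : extremal_op R K = direct_sum (skew_block vertical slope).
Proof. by []. Qed.

Lemma phi_gt0 j : 0 < phi j :> R.
Proof. by rewrite divr_gt0// mulr_gt0// pi_gt0. Qed.

(** Index reversal realizes complex conjugation of the eigenvalues, and turns lower bounds on the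
    angles into upper ones. *)
Lemma phi_rev j : phi (rev_ord j) = pi *+ 2 - phi j :> R.
Proof.
rewrite /phi /= subSS; have jK : (j <= K)%N by rewrite -ltnS.
rewrite -!muln2 -!natr1 !natrM natrB//; field.
by rewrite natr1 pnatr_eq0.
Qed.

Lemma phi_lt2pi j : phi j < pi *+ 2 :> R.
Proof. by rewrite -subr_gt0 -phi_rev phi_gt0. Qed.

Lemma sin_half_phi_gt0 j : 0 < sin (phi j / 2) :> R.
Proof.
by have := phi_gt0 j; have := phi_lt2pi j; rewrite mulr2n => *; apply: sin_gt0_pi; lra.
Qed.

Lemma cos_half_phi j : ~~ vertical j -> cos (phi j / 2) != 0 :> R.
Proof.
apply: contraNneq => c0; rewrite /vertical.
have := phi_gt0 j; have := phi_lt2pi j; rewrite mulr2n => *.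
have : phi j / 2 = pi / 2 :> R.
  by apply: cos_inj; rewrite ?cos_pihalf// in_itv /=; apply/andP; split; lra.
by move=> ?; apply/eqP; lra.
Qed.

Lemma zetaE j : zeta j = (if vertical j then 0 else (1 + (slope j)*i)^-1) :> R[i].
Proof.
rewrite /zeta /omega; case: ifP => [/eqP ->|/negbT vj].
  by rewrite cospi sinpi -[_ +i* _]/((-1)%:C) rmorphN1 subrr mul0r.
have := @half_turn_resolvent R (- (phi j / 2)).
rewrite cosN tanN => /(_ (cos_half_phi vj)) ->.
by rewrite mulNrn opprK [_ / _ *+ 2]mulr2n -splitr.
Qed.

Lemma extremal_instance : is_instance ip_blocks (extremal_op R K).
Proof. exact: skew_instance. Qed.

Lemma extremal_resolvent (x : blocks R K.+1) j :
  resolvent (extremal_op R K) x j = zeta j * x j.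
Proof. by rewrite extremal_skew skew_resolvent zetaE. Qed.

Lemma extremal_zeros : zeros (extremal_op R K) = [set 0].
Proof.
apply: skew_zeros => j vj; rewrite /slope oppr_eq0 /tan mulf_eq0 invr_eq0 negb_or.
by rewrite (gt_eqF (sin_half_phi_gt0 j)) cos_half_phi.
Qed.

Lemma zeta_conj j : zeta (rev_ord j) = (zeta j)^* :> R[i].
Proof.
rewrite /zeta -[omega j]/(expi (phi j)) -[omega _]/(expi (phi (rev_ord j))).
by rewrite phi_rev expiD (expi2pi R 1) mul1r -conjc_expi fmorph_div rmorphD rmorph1 rmorph_nat.
Qed.

Lemma normc_sub1_zeta j : Normc.normc (1 - zeta j) = sin (phi j / 2) :> R.
Proof. by rewrite [LHS]normc_sub1_expi ger0_norm// ltW// sin_half_phi_gt0. Qed.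

Lemma half_phi0 : @phi R K ord0 / 2 = pi / (2 * K.+1%:R) :> R.
Proof. by rewrite /phi mul1r invfM mulrA mulrAC. Qed.

Lemma sin_half_phi_min j : sin (@phi R K ord0 / 2) <= sin (phi j / 2) :> R.
Proof.
have le0 (i : 'I_K.+1) : phi (ord0 : 'I_K.+1) <= phi i :> R.
  by rewrite /phi !ler_wpM2r ?invr_ge0 ?pi_ge0// ler_nat ltnS leq0n.
have := le0 j; have := le0 (rev_ord j); rewrite phi_rev mulr2n => *.
by apply: sin_min; have := phi_gt0 (ord0 : 'I_K.+1); lra.
Qed.

Lemma extremal_floor :
  floor_of (resolvent (extremal_op R K)) = sin (pi / (2 * K.+1%:R)).
Proof.
rewrite (@floor_diag _ _ (@zeta R K) _ ord0).
- by rewrite normc_sub1_zeta half_phi0.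
- exact: extremal_resolvent.
- by move=> j; exists (rev_ord j); exact: zeta_conj.
by move=> j; rewrite !normc_sub1_zeta sin_half_phi_min.
Qed.

Lemma extremal_floor_min :
  \big[Num.min/Normc.normc (@zeta R K ord0 - 1)]_(j < K.+1)
    Normc.normc (@zeta R K j - 1) = sin (pi / (2 * K.+1%:R)).
Proof.
have normE j : Normc.normc (zeta j - 1) = sin (phi j / 2) :> R.
  by rewrite -normc_sub1_zeta -(normcN (_ : Rcomplex R)) opprB.
rewrite -half_phi0 -normE; apply/eqP; rewrite eq_le; apply/andP; split.
  exact: bigmin_le_id.
by apply: le_bigmin => // j _; rewrite !normE sin_half_phi_min.
Qed.

Lemma omega_expi j : omega j = expi (phi j) :> R[i]. Proof. by []. Qed.

(** With u = (k - l) pi / n the summand is e^{iu} e^{2iuj}. For k != l this is a geometric sum of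
    ratio e^{2iu}, where 0 < |2u| < 2 pi and 2un is a multiple of 2 pi. *)
Lemma omega_orthogonal (k l : 'I_K.+1) :
  \sum_j (@omega R K j) ^+ k * conjc (omega j) ^+ l = (K.+1 * (k == l))%:R.
Proof.
pose u : R := (k%:R - l%:R) * pi / K.+1%:R.
have n0 : K.+1%:R != 0 :> R by rewrite pnatr_eq0.
have termE (j : 'I_K.+1) :
    (@omega R K j) ^+ k * conjc (omega j) ^+ l = expi u * expi (u *+ 2) ^+ j.
  rewrite omega_expi conjc_expi !expiXn -!expiD; congr expi.
  rewrite -[_ *+ k]mulr_natr -[_ *+ l]mulr_natr -[_ *+ j]mulr_natr -[u *+ 2]mulr_natr.
  by rewrite /phi /u -[j.*2.+1]addn1 -muln2 natrD natrM; ring.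
under eq_bigr do rewrite termE; rewrite -mulr_sumr.
have [kl|kl] := eqVneq k l.
  rewrite /u kl subrr !mul0r mul0rn expi0 mul1r muln1.
  by under eq_bigr do rewrite expr1n; rewrite sumr_const card_ord.
rewrite muln0 sum_expi ?mulr0//.
- rewrite -subr_gt0 opprK -mulrnDl pmulrn_lgt0//.
  have -> : u + pi = (K.+1%:R + k%:R - l%:R) * pi / K.+1%:R by rewrite /u; field.
  rewrite divr_gt0// mulr_gt0 ?pi_gt0// subr_gt0 -natrD ltr_nat.
  by apply: leq_trans (ltn_ord l) (leq_addr _ _).
- rewrite -subr_gt0 -mulrnBl pmulrn_lgt0//.
  have -> : pi - u = (K.+1%:R + l%:R - k%:R) * pi / K.+1%:R by rewrite /u; field.
  rewrite divr_gt0// mulr_gt0 ?pi_gt0// subr_gt0 -natrD ltr_nat.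
  by apply: leq_trans (ltn_ord k) (leq_addr _ _).
- by rewrite mulrn_eq0 /= !mulf_neq0 ?invr_eq0 ?subr_eq0 ?eqr_nat// gt_eqF ?pi_gt0.
rewrite expiXn.
have -> : u *+ 2 *+ K.+1 = pi *+ 2 *+ k - pi *+ 2 *+ l.
  rewrite -mulrnA -[u *+ _]mulr_natr -[_ *+ k]mulr_natr -[_ *+ l]mulr_natr.
  by rewrite -[pi *+ 2]mulr_natr natrM /u; field.
by rewrite expiD -conjc_expi !expi2pi rmorph1 mulr1.
Qed.

Lemma extremal_parseval (P : {poly R}) : (size P <= K.+1)%N ->
  \sum_(j < K.+1) Normc.normc (map_poly (real_complex R) P).[omega j] ^+ 2 =
  K.+1%:R * \sum_(k < K.+1) P`_k ^+ 2.
Proof.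
have [cw cwE orthogonal] : exists2 cw : 'I_K.+1 -> R[i], forall j, cw j = conjc (omega j) &
    forall k l : 'I_K.+1, \sum_j omega j ^+ k * cw j ^+ l = (K.+1 * (k == l))%:R.
  by exists (fun j => conjc (omega j)) => // k l; exact: omega_orthogonal.
move=> sP; apply: complexI; rewrite rmorph_sum rmorphM rmorph_nat rmorph_sum.
have evalE (z : R[i]) : (map_poly (real_complex R) P).[z] = \sum_(k < K.+1) (P`_k)%:C * z ^+ k.
  rewrite (horner_coef_wide _ (leq_trans (size_poly _ _) sP)).
  by apply: eq_bigr => k _; rewrite coef_map.
have termE (j : 'I_K.+1) :
    (Normc.normc (map_poly (real_complex R) P).[omega j] ^+ 2)%:C =
    \sum_(k < K.+1) \sum_(l < K.+1)
      (P`_k * P`_l)%:C * ((@omega R K j) ^+ k * cw j ^+ l).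
  rewrite normc_sqrC evalE cwE; move: (omega j) => w; rewrite rmorph_sum big_distrlr /=.
  apply: eq_bigr => k _; apply: eq_bigr => l _.
  rewrite rmorphM rmorphXn /= -[Num.conj w]/(conjc w).
  have -> : Num.conj (P`_l)%:C = (P`_l)%:C by exact: conj_real.
  by rewrite rmorphM /=; ring.
rewrite (eq_bigr _ (fun j _ => termE j)).
rewrite exchange_big mulr_sumr; apply: eq_bigr => k _.
rewrite exchange_big (bigD1 k)//= [X in _ + X]big1 => [|l /= lk].
  by rewrite -mulr_sumr orthogonal eqxx muln1 addr0 mulrC expr2.
by rewrite -mulr_sumr orthogonal eq_sym (negPf lk) muln0 mulr0.
Qed.

Lemma omega_pow j : omega j ^+ K.+1 = -1 :> R[i].
Proof.
rewrite omega_expi expiXn.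
have -> : phi j *+ K.+1 = pi *+ 2 *+ j + pi :> R.
  rewrite -[_ *+ K.+1]mulr_natr -[_ *+ j]mulr_natr -[pi *+ 2]mulr_natr /phi.
  by rewrite divfK ?pnatr_eq0// -[j.*2.+1]addn1 -muln2 natrD natrM; ring.
rewrite expiD expi2pi mul1r /expi cospi sinpi.
by apply/eqP; rewrite eq_complex /= oppr0 !eqxx.
Qed.

Lemma weightE j : weight j = (K.+1%:R * sin (phi j / 2)) ^- 2 :> R.
Proof.
by rewrite /weight /csc; field; rewrite (lt0r_neq0 (sin_half_phi_gt0 j)) addrC natr1 pnatr_eq0.
Qed.

(** Parseval for P = 1 + X + ... + X^K: since omega_j^n = -1, P(omega_j) = 2 / (1 - omega_j) has
    modulus 1 / sin (phi_j / 2), so the squared cosecants sum to n^2. *)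
Lemma sum_weight : \sum_(j < K.+1) weight j = 1 :> R.
Proof.
pose P : {poly R} := \poly_(k < K.+1) 1.
have sP : (size P <= K.+1)%N by exact: size_poly.
have n0 : K.+1%:R != 0 :> R by rewrite pnatr_eq0.
have normP (j : 'I_K.+1) :
    Normc.normc (map_poly (real_complex R) P).[omega j] = (sin (phi j / 2))^-1.
  have s0 := sin_half_phi_gt0 j; apply: (mulIf (lt0r_neq0 s0)).
  rewrite mulVf ?lt0r_neq0// -normc_sub1_zeta -Normc.normcM -[RHS]Normc.normc1; congr Normc.normc.
  have -> : 1 - zeta j = (1 - omega j) / 2 :> R[i] by rewrite /zeta; field.
  rewrite mulrA.
  suff -> : (map_poly (real_complex R) P).[omega j] * (1 - omega j) = 2.
    by rewrite divff// pnatr_eq0.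
  have := subrX1 (@omega R K j) K.+1; rewrite omega_pow => E.
  rewrite (horner_coef_wide _ (leq_trans (size_poly _ _) sP)).
  have -> : \sum_(i < K.+1) (map_poly (real_complex R) P)`_i * omega j ^+ i =
            \sum_(i < K.+1) @omega R K j ^+ i.
    by apply: eq_bigr => i _; rewrite coef_map coef_poly ltn_ord; exact: mul1r.
  rewrite mulrC -opprB mulNr -E; ring.
have := extremal_parseval sP; under eq_bigr do rewrite normP exprVn.
under [X in _ * X]eq_bigr do rewrite coef_poly ltn_ord expr1n.
rewrite sumr_const card_ord => E.
under eq_bigr do rewrite weightE exprMn invfM.
by rewrite -mulr_sumr E; field.
Qed.

Lemma extremal_start_norm (y0 : blocks R K.+1) :
  extremal_start y0 -> hnorm ip_blocks y0 = 1.
Proof.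
move=> start; apply/eqP; rewrite -(@eqrXn2 _ 2) ?hnorm_ge0// expr1n hnorm_blocks_sqr -sum_weight.
apply/eqP; apply: eq_bigr => j _; rewrite start sqr_sqrtr// weightE invr_ge0.
exact: sqr_ge0.
Qed.

Lemma extremal_lower_bound (y0 : blocks R K.+1) m : extremal_start y0 ->
  K.+1%:R^-1 <= final_residual ip_blocks (extremal_op R K) y0 K m.
Proof.
move=> start.
have L_diag (x : blocks R K.+1) j : resolvent (extremal_op R K) x j = (1 + omega j) / 2%:R * x j.
  exact: extremal_resolvent.
have [P [sP P1 xE]] := krylov_iterate L_diag m y0 K.
have n0 : 0 < K.+1%:R :> R by rewrite ltr0n.
rewrite -(@ler_pXn2r _ 2) ?nnegrE ?hnorm_ge0 ?invr_ge0 ?ler0n// /final_residual /residual.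
rewrite (hnorm_diag L_diag xE).
have termE (j : 'I_K.+1) :
    (Normc.normc (1 - (1 + omega j) / 2%:R) * Normc.normc (y0 j)) ^+ 2 = K.+1%:R ^- 2 :> R.
  rewrite start -[_ / 2%:R]/(zeta j) normc_sub1_zeta weightE exprMn sqr_sqrtr ?invr_ge0 ?sqr_ge0//.
  by field; rewrite (lt0r_neq0 (sin_half_phi_gt0 j)) addrC natr1 pnatr_eq0.
under eq_bigr do rewrite termE.
rewrite -mulr_sumr extremal_parseval// exprVn ler_peMr ?invr_ge0 ?exprn_ge0 ?ler0n//.
have sum1 : \sum_(k < K.+1) P`_k = 1.
  by rewrite -P1 (horner_coef_wide _ sP); apply: eq_bigr => i _; rewrite expr1n mulr1.
(* The spread of the coefficients about their mean 1/n is nonnegative, hence the sum of their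
   squares is at least 1/n. *)
have : 0 <= \sum_(k < K.+1) (P`_k - K.+1%:R^-1) ^+ 2 by apply: sumr_ge0 => k _; exact: sqr_ge0.
have -> : \sum_(k < K.+1) (P`_k - K.+1%:R^-1) ^+ 2 =
   \sum_(k < K.+1) P`_k ^+ 2 - 2 * K.+1%:R^-1 * \sum_(k < K.+1) P`_k + K.+1%:R * K.+1%:R ^- 2.
  transitivity (\sum_(k < K.+1) (P`_k ^+ 2 - 2 * K.+1%:R^-1 * P`_k + K.+1%:R ^- 2)).
    by apply: eq_bigr => k _; field; exact: lt0r_neq0.
  rewrite big_split /= sumrB -mulr_sumr sumr_const card_ord.
  by congr (_ + _); rewrite mulr_natl.
rewrite sum1 => h.
have := mulr_ge0 (ltW n0) h; rewrite -subr_ge0 => h'; apply: le_trans h' _.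
rewrite le_eqVlt; apply/orP; left; apply/eqP; field.
exact: lt0r_neq0.
Qed.

End ExtremalInstance.

(** * The roots-of-unity rotation instance *)

Section RotationInstance.
Variables (R : realType) (K : nat).
Implicit Type j : 'I_K.+1.

Let vertical j := theta j == pi / 2%:R :> R.
Let slope j : R := tan (theta j).
Let om j : R[i] := expi (- (theta j *+ 2)).

Lemma rotation_skew : rotation_op R K = direct_sum (skew_block vertical slope).
Proof.
rewrite /rotation_op; congr direct_sum; apply: funext => j; apply: funext => z.
rewrite /rotation_block /skew_block -/(vertical j); case: ifP => // _; congr [set _].
by case: z => a b; apply/eqP; rewrite eq_complex /slope /=; apply/andP; split; apply/eqP; ring.
Qed.

Lemma theta_gt0 j : 0 < theta j :> R.
Proof. by rewrite divr_gt0// mulr_gt0// pi_gt0. Qed.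

Lemma theta_rev j : theta (rev_ord j) = pi - theta j :> R.
Proof.
rewrite /theta /= subSS; have jK : (j <= K)%N by rewrite -ltnS.
rewrite -!natr1 natrB//; field.
by apply: lt0r_neq0; have := ler0n R K; lra.
Qed.

Lemma theta_ltpi j : theta j < pi :> R.
Proof. by rewrite -subr_gt0 -theta_rev theta_gt0. Qed.

Lemma sin_theta_gt0 j : 0 < sin (theta j) :> R.
Proof. by apply: sin_gt0_pi; rewrite theta_gt0 theta_ltpi. Qed.

Lemma cos_theta j : ~~ vertical j -> cos (theta j) != 0 :> R.
Proof.
apply: contraNneq => c0; rewrite /vertical.
have := theta_gt0 j; have := theta_ltpi j => *.
by apply/eqP/cos_inj; rewrite ?cos_pihalf// in_itv /=; apply/andP; split; lra.
Qed.

Lemma rotation_instance : is_instance ip_blocks (rotation_op R K).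
Proof. by rewrite rotation_skew; exact: skew_instance. Qed.

Lemma rotation_resolvent (x : blocks R K.+1) j :
  resolvent (rotation_op R K) x j = (1 + om j) / 2%:R * x j.
Proof.
rewrite rotation_skew skew_resolvent; congr (_ * _); case: ifP => [/eqP tp|/negbT vj].
  rewrite /om tp [_ / _ *+ 2]mulr2n -splitr /expi cosN sinN cospi sinpi oppr0.
  by rewrite -[_ +i* _]/((-1)%:C) rmorphN1 subrr mul0r.
exact: half_turn_resolvent (cos_theta vj).
Qed.

Lemma om_rev j : om (rev_ord j) = conjc (om j).
Proof.
rewrite /om theta_rev conjc_expi mulrnBl opprB expiD opprK.
by rewrite -[expi (- (pi *+ 2))]conjc_expi (expi2pi R 1) rmorph1 mulr1.
Qed.

Lemma normc_sub1_om j : Normc.normc (1 - (1 + om j) / 2%:R) = sin (theta j).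
Proof.
rewrite normc_sub1_expi (_ : _ / 2 = - theta j); last by rewrite mulr2n; field.
by rewrite sinN normrN ger0_norm// ltW// sin_theta_gt0.
Qed.

Lemma theta_min j : theta (ord0 : 'I_K.+1) <= theta j :> R.
Proof. by rewrite /theta ler_wpM2r ?invr_ge0// ler_wpM2l ?pi_ge0// ler_nat. Qed.

Lemma rotation_floor : floor_of (resolvent (rotation_op R K)) = sin (pi / K.+2%:R).
Proof.
rewrite (@floor_diag _ _ (fun j => (1 + om j) / 2%:R) _ ord0).
- by rewrite normc_sub1_om /theta mulr1.
- exact: rotation_resolvent.
- move=> j; exists (rev_ord j).
  by rewrite om_rev fmorph_div rmorphD rmorph1 rmorph_nat.
move=> j; rewrite !normc_sub1_om; apply: sin_min; rewrite ?theta_gt0 ?theta_min//.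
by have := theta_min (rev_ord j); rewrite theta_rev; lra.
Qed.

Lemma Lambda_gt0 : 0 < Lambda R K.
Proof.
rewrite /Lambda big_ord_recl ltr_pwDl ?sumr_ge0// => [|j _];
  by rewrite ?invr_gt0 ?invr_ge0 ?ltW// sin_theta_gt0.
Qed.

Lemma rotation_residual (y0 x : blocks R K.+1) (P : {poly R}) :
  rotation_start y0 ->
  (forall j, x j = (map_poly (real_complex R) P).[om j] * y0 j) ->
  hnorm ip_blocks (residual (rotation_op R K) x) ^+ 2 =
  (Lambda R K)^-1 *
  \sum_j sin (theta j) * Normc.normc (map_poly (real_complex R) P).[om j] ^+ 2.
Proof.
move=> start xE; rewrite /residual (hnorm_diag rotation_resolvent xE) mulr_sumr.
apply: eq_bigr => j _; rewrite [RHS]mulrA; congr (_ * _).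
have s0 := sin_theta_gt0 j; have L0 := Lambda_gt0.
rewrite start normc_sub1_om exprMn sqr_sqrtr /csc; last by rewrite divr_ge0 ?invr_ge0 ?ltW.
by field; rewrite !lt0r_neq0.
Qed.

Lemma theta2_mul j : theta j *+ 2 *+ K.+2 = pi *+ 2 *+ j.+1 :> R.
Proof.
rewrite -[_ *+ K.+2]mulr_natr -[_ *+ j.+1]mulr_natr -[pi *+ 2]mulr_natr.
by rewrite -[theta j *+ 2]mulr_natr /theta; field; apply: lt0r_neq0; have := ler0n R K; lra.
Qed.

Lemma om_pow j : om j ^+ K.+2 = 1.
Proof. by rewrite expiXn mulNrn theta2_mul -conjc_expi expi2pi rmorph1. Qed.

Lemma conj_om j : conjc (om j) = expi (theta j *+ 2).
Proof. by rewrite /om conjc_expi opprK. Qed.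

Lemma sum_conj_om_om j l : j != l -> \sum_(k < K.+2) (conjc (om j) * om l) ^+ k = 0.
Proof.
move=> jl; rewrite conj_om /om -expiD; apply: sum_expi.
- by have := theta_ltpi l; have := theta_gt0 j; rewrite !mulr2n; lra.
- by have := theta_ltpi j; have := theta_gt0 l; rewrite !mulr2n; lra.
- rewrite -mulrnBl mulrn_eq0 /= subr_eq0; apply: contra jl => /eqP jl.
  have N0 : pi / K.+2%:R != 0 :> R by rewrite lt0r_neq0// divr_gt0// pi_gt0.
  move: jl; rewrite /theta -!mulrA ![pi * _]mulrCA => /(mulIf N0) /eqP.
  by rewrite eqr_nat.
by rewrite expiD exprMn -/(om l) om_pow mulr1 -[expi _]conj_om -rmorphXn om_pow rmorph1.
Qed.

Lemma sum_conj_om j : \sum_(k < K.+2) conjc (om j) ^+ k = 0.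
Proof.
rewrite conj_om; apply: sum_expi.
- by have := theta_gt0 j; have := pi_gt0 R; rewrite !mulr2n; lra.
- by have := theta_ltpi j; rewrite !mulr2n; lra.
- by rewrite mulrn_eq0 /= lt0r_neq0// theta_gt0.
by rewrite -conj_om -rmorphXn om_pow rmorph1.
Qed.

Lemma sum_om j : \sum_(k < K.+2) om j ^+ k = 0.
Proof. by rewrite -[om j]conjcK -om_rev; exact: sum_conj_om. Qed.

(** The power of om_j equals om_k ^ (j+1), so this is the full geometric sum of om_k. *)
Lemma sum_pow_om (k : 'I_K.+1) : 1 + \sum_j om j ^+ k.+1 = 0.
Proof.
rewrite -[RHS](sum_om k) [RHS]big_ord_recl expr0; congr (_ + _); apply: eq_bigr => j _.
rewrite lift0 !expiXn; congr expi; rewrite !mulNrn; congr (- _).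
rewrite -[_ *+ k.+1]mulr_natr -[_ *+ j.+1]mulr_natr.
by rewrite -[theta j *+ 2]mulr_natr -[theta k *+ 2]mulr_natr /theta; ring.
Qed.

(* The interpolation formula at the nontrivial roots of unity of order [K + 2];
   all the weights have modulus 1. *)
Lemma rotation_interpolation (P : {poly R}) : (size P <= K.+1)%N ->
  (P.[1])%:C + \sum_j om j * (map_poly (real_complex R) P).[om j] = 0.
Proof.
move=> sP.
have evalE (z : R[i]) : (map_poly (real_complex R) P).[z] = \sum_(k < K.+1) (P`_k)%:C * z ^+ k.
  rewrite (horner_coef_wide _ (leq_trans (size_poly _ _) sP)).
  by apply: eq_bigr => k _; rewrite coef_map.
have -> : (P.[1])%:C = \sum_(k < K.+1) (P`_k)%:C.
  rewrite (horner_coef_wide _ sP) rmorph_sum; apply: eq_bigr => k _.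
  by rewrite expr1n mulr1.
have -> : \sum_j om j * (map_poly (real_complex R) P).[om j] =
    \sum_j \sum_(k < K.+1) om j * ((P`_k)%:C * om j ^+ k).
  by apply: eq_bigr => j _; rewrite evalE mulr_sumr.
rewrite exchange_big -big_split big1// => k _ /=.
under eq_bigr do rewrite mulrCA -exprS.
by rewrite -mulr_sumr -[X in X + _]mulr1 -mulrDr sum_pow_om mulr0.
Qed.

Lemma rotation_lower_bound (y0 : blocks R K.+1) m : rotation_start y0 ->
  (Lambda R K)^-1 <= final_residual ip_blocks (rotation_op R K) y0 K m.
Proof.
move=> start; have L0 := Lambda_gt0.
have [P [sP P1 xE]] := krylov_iterate rotation_resolvent m y0 K.
rewrite -(@ler_pXn2r _ 2) ?nnegrE ?hnorm_ge0 ?invr_ge0 ?(ltW L0)//.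
rewrite [final_residual _ _ _ _ _ ^+ 2](rotation_residual start xE).
rewrite [leLHS]expr2 ler_pM2l ?invr_gt0//.
pose a j := Normc.normc (map_poly (real_complex R) P).[om j].
have sum_a : 1 <= \sum_j a j.
  have := rotation_interpolation sP; rewrite P1 rmorph1 => /eqP.
  rewrite addr_eq0 => /eqP E; rewrite -[leLHS](Normc.normc1 R) E (normcN (_ : Rcomplex R)).
  apply: le_trans (normc_sum _) _; rewrite le_eqVlt; apply/orP; left; apply/eqP.
  by apply: eq_bigr => j _; rewrite Normc.normcM normc_expi mul1r.
(* Weighted Cauchy-Schwarz, as a square centred at its equality case; the cosecants sum to
   [Lambda]. *)
have : 0 <= \sum_j sin (theta j) * (a j - (sin (theta j) * Lambda R K)^-1) ^+ 2.
  by apply: sumr_ge0 => j _; rewrite mulr_ge0 ?sqr_ge0// ltW// sin_theta_gt0.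
have -> : \sum_j sin (theta j) * (a j - (sin (theta j) * Lambda R K)^-1) ^+ 2 =
  \sum_j sin (theta j) * a j ^+ 2 - 2 / Lambda R K * \sum_j a j + (Lambda R K)^-1.
  have E : (Lambda R K)^-1 = (Lambda R K) ^- 2 * \sum_(j < K.+1) csc (theta j).
    by rewrite -/(Lambda R K); field; exact: lt0r_neq0.
  rewrite [X in _ + X]E !mulr_sumr -sumrB -big_split; apply: eq_bigr => j _ /=.
  by rewrite /csc; field; rewrite !lt0r_neq0// sin_theta_gt0.
have := ler_wpM2l (_ : 0 <= 2 / Lambda R K) sum_a; rewrite divr_ge0 ?(ltW L0)// => /(_ isT).
by rewrite mulr1 mulrC; rewrite -/(a _); lra.
Qed.

(** Equality case of the lower bound: [P] interpolates 1 at 1 and -c_j conj(om_j) at om_j. The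
    numbers [q k] are its coefficients by Fourier inversion on the roots of unity of order K+2. *)
Lemma rotation_optimal_poly : exists P : {poly R}, [/\ (size P <= K.+1)%N, P.[1] = 1 &
  forall j, Normc.normc (map_poly (real_complex R) P).[om j] = (sin (theta j) * Lambda R K)^-1].
Proof.
have L0 := Lambda_gt0; have N0 : K.+2%:R != 0 :> R[i] by rewrite pnatr_eq0.
pose c j : R := (sin (theta j) * Lambda R K)^-1.
have c_gt0 j : 0 < c j by rewrite invr_gt0 mulr_gt0// sin_theta_gt0.
have c_rev j : c (rev_ord j) = c j by rewrite /c theta_rev sin_pi_sub.
have sum_c : \sum_j c j = 1.
  rewrite -[RHS](mulVf (lt0r_neq0 L0)) [in RHS]/Lambda mulr_sumr.
  by apply: eq_bigr => j _; rewrite /c /csc invfM mulrC.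
pose q k : R := K.+2%:R^-1 * (1 - \sum_j c j * cos (theta j *+ 2 *+ k.+1)).
have qE k : (q k)%:C = K.+2%:R^-1 * (1 - \sum_j (c j)%:C * conjc (om j) ^+ k.+1).
  (* The coefficients are real: sine terms change sign under index reversal, while [c] is
     symmetric. *)
  have sin0 : \sum_j c j * sin (theta j *+ 2 *+ k.+1) = 0.
    set S := \sum_j _.
    have : S = - S.
      rewrite {1}/S (reindex_inj rev_ord_inj) /= -sumrN; apply: eq_bigr => j _.
      rewrite c_rev theta_rev !mulrnBl sinB.
      have := expi2pi R k.+1; rewrite /expi => -[-> ->].
      by rewrite mul0r mul1r sub0r mulrN.
    by lra.
  rewrite /q rmorphM fmorphV rmorph_nat rmorphB rmorph1; congr (_ * (1 - _)).
  have -> : \sum_j (c j)%:C * conjc (om j) ^+ k.+1 =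
      \sum_j (c j)%:C * expi (theta j *+ 2 *+ k.+1).
    by apply: eq_bigr => j _; rewrite conj_om expiXn.
  transitivity ((\sum_j c j * cos (theta j *+ 2 *+ k.+1))%:C +
                'i%C * (\sum_j c j * sin (theta j *+ 2 *+ k.+1))%:C).
    by rewrite sin0 mulr0 addr0.
  rewrite !(rmorph_sum (real_complex R)) mulr_sumr -big_split; apply: eq_bigr => j _ /=.
  by rewrite [expi _]complexE /= !rmorphM /=; ring.
(* The top coefficient cancels because the [c j] sum to 1, bringing the degree down to K. *)
have q_last : q K.+1 = 0.
  rewrite /q (_ : \sum_j _ = 1) ?subrr ?mulr0// -[RHS]sum_c; apply: eq_bigr => j _.
  by rewrite theta2_mul; have := expi2pi R j.+1; rewrite /expi => -[-> _]; rewrite mulr1.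
pose P : {poly R} := \poly_(k < K.+1) q k.
have evalP (z : R[i]) : (map_poly (real_complex R) P).[z] =
    K.+2%:R^-1 * (\sum_(k < K.+2) z ^+ k -
      \sum_j (c j)%:C * conjc (om j) * \sum_(k < K.+2) (conjc (om j) * z) ^+ k).
  transitivity (\sum_(k < K.+2) (q k)%:C * z ^+ k).
    rewrite [RHS]big_ord_recr /= q_last mul0r addr0.
    rewrite (horner_coef_wide _ (leq_trans (size_poly _ _) (size_poly _ _))).
    by apply: eq_bigr => k _; rewrite coef_map coef_poly ltn_ord.
  under [X in _ - X]eq_bigr do rewrite mulr_sumr.
  rewrite exchange_big -sumrB mulr_sumr; apply: eq_bigr => k _.
  rewrite qE -mulrA mulrBl mul1r mulr_suml; congr (_ * (_ - _)).
  by apply: eq_bigr => j _; rewrite exprMn exprS; ring.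
exists P; split; first exact: size_poly.
  apply: complexI; rewrite -horner_map evalP rmorph1.
  under eq_bigr do rewrite expr1n.
  rewrite sumr_const card_ord big1 ?subr0 ?mulVf// => j _.
  by under eq_bigr do rewrite mulr1; rewrite sum_conj_om mulr0.
move=> l; rewrite evalP sum_om sub0r.
rewrite (eq_bigr (fun j => (c j)%:C * expi (theta j *+ 2) * (if j == l then K.+2%:R else 0))).
  rewrite (bigD1 l)//= eqxx big1 => [|j /negPf ->]; last by rewrite mulr0.
  rewrite addr0 mulrN mulrCA mulVf// mulr1 (normcN (_ : Rcomplex R)) Normc.normcM.
  by rewrite normc_expi mulr1 normc_real ?ltW.
move=> j _; rewrite -conj_om; congr (_ * _); case: eqP => [->|/eqP]; last exact: sum_conj_om_om.
rewrite conj_om -expiD subrr expi0.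
by under eq_bigr do rewrite expr1n; rewrite sumr_const card_ord.
Qed.

End RotationInstance.

Lemma rotation_minimax (R : realType) (K : nat) (y0 : blocks R K.+2) :
  rotation_start y0 ->
  minimax ip_blocks (rotation_op R K.+1) y0 K.+1 = (Lambda R K.+1)^-1.
Proof.
move=> start; have L0 := Lambda_gt0 R K.+1; apply/eqP; rewrite eq_le; apply/andP; split.
  have [P [sP P1 normP]] := rotation_optimal_poly R K.+1.
  have [m mE] := method_of_poly (@rotation_resolvent R K.+1) y0 sP P1.
  apply: le_trans (minimax_le _ _ _ _ m) _.
  rewrite -(@ler_pXn2r _ 2) ?nnegrE ?hnorm_ge0 ?invr_ge0 ?(ltW L0)//.
  rewrite [final_residual _ _ _ _ _ ^+ 2](rotation_residual start mE).
  rewrite [leRHS]expr2 ler_pM2l ?invr_gt0//.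
  have -> : (Lambda R K.+1)^-1 = (Lambda R K.+1) ^- 2 * \sum_(j < K.+2) csc (theta j).
    by rewrite -/(Lambda R K.+1); field; exact: lt0r_neq0.
  rewrite mulr_sumr le_eqVlt; apply/orP; left; apply/eqP; apply: eq_bigr => j _.
  by rewrite normP /csc; field; rewrite !lt0r_neq0// sin_theta_gt0.
by apply: minimax_ge => m; exact: rotation_lower_bound.
Qed.

Local Close Scope complex_scope.

(** * Asymptotics *)

Section Asymptotics.
Variable R : realType.

Lemma sin_mean_value (x : R) : 0 < x -> exists2 c, 0 < c < x & sin x = cos c * x.
Proof.
move=> x0.
have [c] := MVT x0 (fun y _ => is_derive_sin y) (continuous_subspaceT (@continuous_sin R)).
by rewrite in_itv /= sin0 !subr0 => ? ?; exists c.
Qed.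

Lemma sin_le_id (x : R) : 0 < x -> sin x <= x.
Proof. by move=> /[dup] x0 /sin_mean_value[c _ ->]; rewrite ler_piMl ?cos_le1// ltW. Qed.

(** sin x = 2 sin (x/2) cos (x/2), where the mean value theorem gives sin (x/2) >= (x/2) cos (x/2),
    and 2 cos^2 (x/2) = 1 + cos x >= 1. *)
Lemma sin_ge_half (x : R) : 0 < x -> x <= pi / 2 -> x / 2 <= sin x.
Proof.
move=> x0 xpi; have y0 : 0 < x / 2 by rewrite divr_gt0.
have pi0 := pi_gt0 R.
have [c /andP[c0 cx] sE] := sin_mean_value y0.
have cc : cos (x / 2) <= cos c.
  by rewrite ltW// ltr_cos// in_itv /=; apply/andP; split; lra.
have cx0 : 0 <= cos x by apply: cos_ge0_pihalf; rewrite xpi andbT; lra.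
have cy0 : 0 <= cos (x / 2) by apply: cos_ge0_pihalf; apply/andP; split; lra.
have cE := cosD (x / 2) (x / 2); have sxE := sinD (x / 2) (x / 2).
rewrite -splitr in cE; rewrite -splitr in sxE; have cs := cos2Dsin2 (x / 2).
have c2 : 1 <= 2 * (cos (x / 2) * cos (x / 2)) by rewrite !expr2 in cs; lra.
have : cos (x / 2) * cos (x / 2) <= cos c * cos (x / 2) by rewrite ler_wpM2r.
by rewrite sxE sE; nra.
Qed.

(** Up to pi/2 the first term alone suffices; the bound is symmetric under x -> pi - x. *)
Lemma csc_le (x : R) : 0 < x -> x < pi -> csc x <= 2 / x + 2 / (pi - x).
Proof.
wlog : x / x <= pi / 2 => [H x0 xpi|x2 x0 xpi].
  have [|x2] := lerP x (pi / 2); first by move=> x2; exact: H.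
  have : csc (pi - x) <= 2 / (pi - x) + 2 / (pi - (pi - x)) by apply: H; lra.
  by rewrite /csc sin_pi_sub subKr [leRHS]addrC.
rewrite ler_wpDr ?divr_ge0 ?subr_ge0 ?(ltW xpi)// -[2 / x]invrK invf_div lef_pV2 ?posrE ?divr_gt0//.
  exact: sin_ge_half.
by apply: sin_gt0_pi; rewrite x0.
Qed.

Lemma ln_le_harmonic m : ln m.+1%:R <= \sum_(j < m) j.+1%:R^-1 :> R.
Proof.
elim: m => [|m IH]; first by rewrite big_ord0 ln1.
rewrite big_ord_recr /=.
have -> : m.+2%:R = m.+1%:R * (1 + m.+1%:R^-1) :> R.
  by rewrite mulrDr mulr1 divff ?pnatr_eq0// natr1.
have m0 : 0 < m.+1%:R :> R by rewrite ltr0n.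
rewrite lnM ?posrE ?addr_gt0 ?invr_gt0//; apply: lerD => //.
by apply: le_ln1Dx; rewrite (lt_trans _ (_ : 0 < _)) ?invr_gt0// ltrN10.
Qed.

Lemma harmonic_le_ln m : \sum_(j < m.+1) j.+1%:R^-1 <= 1 + ln m.+1%:R :> R.
Proof.
elim: m => [|m IH]; first by rewrite big_ord1 ln1 invr1 addr0.
rewrite big_ord_recr /=.
have m0 : 0 < m.+1%:R :> R by rewrite ltr0n.
have m1 : 0 < m.+2%:R :> R by rewrite ltr0n.
have E : m.+1%:R = m.+2%:R * (1 + - m.+2%:R^-1) :> R.
  by rewrite mulrDr mulr1 mulrN divff ?gt_eqF// -[m.+2%:R]natr1 addrK.
have gt1 : - 1 < - m.+2%:R^-1 :> R by rewrite ltrN2 invf_lt1// ltr1n.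
have := le_ln1Dx gt1.
have : ln m.+1%:R = ln m.+2%:R + ln (1 + - m.+2%:R^-1) :> R.
  by rewrite -lnM ?posrE -?E// -ltrBlDl sub0r.
by move: IH m.+2%:R^-1 {E gt1} => IH v; lra.
Qed.

(** csc theta_j >= 1 / theta_j, and these reciprocals sum to (K+2) / pi times a harmonic sum. *)
Lemma Lambda_ge K : (1 <= K)%N -> pi^-1 * ln K%:R <= K.+1%:R^-1 * Lambda R K.
Proof.
move=> K1; have pi0 := pi_gt0 R.
have : K.+2%:R / pi * ln K.+2%:R <= Lambda R K.
  apply: le_trans (ler_wpM2l _ (ln_le_harmonic K.+1)) _; first by rewrite divr_ge0// ltW.
  rewrite mulr_sumr; apply: ler_sum => j _; rewrite /csc.
  have -> : K.+2%:R / pi * j.+1%:R^-1 = (@theta R K j)^-1.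
    by rewrite /theta !invfM invrK; ring.
  by rewrite lef_pV2 ?posrE ?theta_gt0 ?sin_theta_gt0// sin_le_id ?theta_gt0.
move=> le; apply: le_trans (ler_wpM2l _ le); last by rewrite invr_ge0.
have K0 : 0 < K.+1%:R :> R by rewrite ltr0n.
have k0 : 0 < K%:R :> R by rewrite ltr0n.
have lnle : ln K%:R <= ln K.+2%:R :> R by rewrite ler_ln ?posrE ?ltr0n// ler_nat ltnW.
apply: le_trans (ler_wpM2l _ lnle) _; first by rewrite invr_ge0 ltW.
rewrite [leRHS](_ : _ = K.+2%:R / K.+1%:R * (pi^-1 * ln K.+2%:R)); last by ring.
rewrite ler_peMl ?mulr_ge0 ?invr_ge0 ?(ltW pi0) ?ln_ge0 ?ler1n//.
by rewrite ler_pdivlMr// mul1r ler_nat.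
Qed.

Lemma Lambda_le K : (2 <= K)%N ->
  K.+1%:R^-1 * Lambda R K <= 8 * ((ln 2)^-1 + 2) * ln K%:R.
Proof.
move=> K2; have pi0 := pi_gt0 R.
have K0 : 0 < K.+1%:R :> R by rewrite ltr0n.
have k0 : 0 < K%:R :> R by rewrite ltr0n ltnW.
have ln2 : 0 < ln 2 :> R by rewrite ln_gt0// ltr1n.
have thetaV : \sum_(j < K.+1) (@theta R K j)^-1 = K.+2%:R / pi * \sum_(j < K.+1) j.+1%:R^-1.
  by rewrite mulr_sumr; apply: eq_bigr => j _; rewrite /theta !invfM invrK; ring.
have : Lambda R K <= 4 * (K.+2%:R / pi * (1 + ln K.+1%:R)).
  apply: (@le_trans _ _ (\sum_(j < K.+1) (2 / theta j + 2 / theta (rev_ord j)))).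
    by apply: ler_sum => j _; rewrite theta_rev csc_le ?theta_gt0 ?theta_ltpi.
  have revE : \sum_(j < K.+1) 2 / theta (rev_ord j) = \sum_(j < K.+1) 2 / theta j :> R.
    by rewrite (reindex_inj rev_ord_inj) /=; apply: eq_bigr => j _; rewrite rev_ordK.
  rewrite big_split /= revE -!mulr_sumr.
  rewrite -mulrDl thetaV (_ : 2 + 2 = 4); last by ring.
  by do 2! [apply: ler_wpM2l; first by rewrite ?divr_ge0// ltW]; exact: harmonic_le_ln.
move=> le; apply: le_trans (ler_wpM2l _ le) _; first by rewrite invr_ge0.
(* K + 1 <= K^2 for K >= 2; next, 1 <= ln K / ln 2 absorbs the additive constant. *)
have lnK1 : ln K.+1%:R <= 2 * ln K%:R :> R.
  rewrite mulr_natl -lnXn// ler_ln ?posrE ?exprn_gt0// -natrX ler_nat.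
  by rewrite expnS expn1; case: K K2 {K0 k0 thetaV le} => [|[|K]]// _; rewrite mulSn; lia.
have lnK : 1 <= (ln 2)^-1 * ln K%:R :> R.
  by rewrite mulrC ler_pdivlMr// mul1r ler_ln ?posrE// ler_nat.
rewrite [leLHS](_ : _ = 4 * (K.+2%:R / K.+1%:R / pi) * (1 + ln K.+1%:R)); last by ring.
have N2 : K.+2%:R / K.+1%:R / pi <= 2 :> R.
  rewrite !ler_pdivrMr//; have := pi_ge2 R; have : K.+2%:R <= 2 * K.+1%:R :> R.
    by rewrite -natrM ler_nat mul2n -addnn addnS addSn ltnS ltnS leq_addr.
  by nra.
have N0 : 0 <= K.+2%:R / K.+1%:R / pi :> R by rewrite !divr_ge0// ltW.
have l0 : 0 <= 1 + ln K.+1%:R :> R by rewrite addr_ge0// ln_ge0// ler1n.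
have : (K.+2%:R / K.+1%:R / pi) * (1 + ln K.+1%:R) <= 2 * (1 + ln K.+1%:R) :> R
  by rewrite ler_wpM2r.
move: (K.+2%:R / K.+1%:R / pi) (ln 2)^-1 (ln K.+1%:R) (ln K%:R) lnK1 lnK {N2 N0 l0} => q i l l'.
by lra.
Qed.

Lemma rotation_theta (y0 : forall K : nat, blocks R K.+1) :
  (forall K, rotation_start (y0 K)) ->
  (fun K : nat =>
     K.+1%:R^-1 / minimax ip_blocks (rotation_op R K) (y0 K) K : R^o)
    =Theta_\oo (fun K : nat => ln K%:R : R^o).
Proof.
move=> start; rewrite eqThetaE qualifE; apply/asboolP.
exists (pi^-1, 8 * ((ln 2)^-1 + 2)) => /=.
  by rewrite invr_gt0 pi_gt0 mulr_gt0// addr_gt0// invr_gt0 ln_gt0// ltr1n.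
exists 2%N => // -[|K] //= K2.
rewrite (rotation_minimax (start K.+1)) invrK.
rewrite !ger0_norm ?mulr_ge0 ?invr_ge0 ?ln_ge0 ?ler1n// ?(ltW (Lambda_gt0 _ _))//.
by split; [exact: Lambda_ge|exact: Lambda_le].
Qed.

End Asymptotics.

(** * Assembly of the two instances *)

Theorem theorem5p2 (R : realType) :
  (forall (K : nat) (s : R) (y0 : blocks R K.+1),
     (1 <= K)%N -> s <= sin (pi / (2 * K.+1%:R)) -> extremal_start y0 ->
     let M := extremal_op R K in
     let L := resolvent M in
     [/\ [/\ is_instance ip_blocks M, hnorm ip_blocks y0 = 1 &
             dist_zeros ip_blocks M y0 = 1],
         (forall (x : blocks R K.+1) (j : 'I_K.+1), L x j = zeta j * x j) /\
         eigenvalues L = range (@zeta R K),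
         [/\ floor_of L =
               \big[Num.min/Normc.normc (@zeta R K ord0 - 1)]_(j < K.+1)
                 Normc.normc (@zeta R K j - 1),
             floor_of L = sin (pi / (2 * K.+1%:R)) &
             s <= floor_of L],
         minimax ip_blocks M y0 K = K.+1%:R^-1 /\
         (forall m : method (blocks R K.+1),
            K.+1%:R^-1 <= hnorm ip_blocks (residual M (iterate m L y0 K))) &
         forall (V : lmodType R) (ip : V -> V -> R) (M' : V -> set V) (z0 : V),
           is_instance ip M' -> dist_zeros ip M' z0 = 1 ->
           minimax ip M' z0 K <= minimax ip_blocks M y0 K]) /\
  (forall y0 : forall K : nat, blocks R K.+1,
     (forall K, rotation_start (y0 K)) ->
     (forall K, (1 <= K)%N ->
        is_instance ip_blocks (rotation_op R K) /\
        floor_of (resolvent (rotation_op R K)) = sin (pi / K.+2%:R)) /\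
     (fun K : nat =>
        K.+1%:R^-1 / minimax ip_blocks (rotation_op R K) (y0 K) K : R^o)
       =Theta_\oo (fun K : nat => ln K%:R : R^o)).
Proof.
split=> [K s y0 K1 sle start M L|y0 start]; last first.
  split=> [K _|]; last exact: rotation_theta.
  by split; [exact: rotation_instance|exact: rotation_floor].
have inst : is_instance ip_blocks M by exact: extremal_instance.
have norm1 : hnorm ip_blocks y0 = 1 by exact: extremal_start_norm.
have dist1 : dist_zeros ip_blocks M y0 = 1.
  by rewrite (dist_zeros_single _ _ (extremal_zeros R K)).
have lower m : K.+1%:R^-1 <= hnorm ip_blocks (residual M (iterate m L y0 K)).
  exact: extremal_lower_bound.
(* The upper half is Halpern's rate at distance 1, the same bound that proves extremality over all
   instances. *)
have minimaxE : minimax ip_blocks M y0 K = K.+1%:R^-1.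
  apply/eqP; rewrite eq_le minimax_dist1//=; exact: minimax_ge.
split=> //.
- split; first exact: extremal_resolvent.
  apply: eigenvalues_diag; first exact: extremal_resolvent.
  by move=> j; exists (rev_ord j); exact: zeta_conj.
- have floorE : floor_of L = sin (pi / (2 * K.+1%:R)) by exact: extremal_floor.
  by rewrite floorE extremal_floor_min.
by move=> V ip M' z0 inst' dist'; rewrite minimaxE; exact: minimax_dist1.
Qed.
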